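(* There is a randomized algorithm that, for any sequence of points $x_1,\dots,x_{2n}$ of a metric space revealed in pairs by an oblivious adversary in an online fashion, with aspect ratio $\Phi$ and doubling dimension $\mathrm{ddim}$ (both unknown in advance), maintains a perfect matching with expected competitive ratio $O(\mathrm{ddim}\cdot\log\Phi)$ and recourse $O(\log\Phi)$. Alternatively (with the same competitive ratio), the recourse can be bounded by $O(\log^3 n)$.
   Context: Online minimum-weight perfect matching with recourse: points $s_1,s_2,\dots$ of a metric space $(X,d_X)$ arrive one pair at a time; when a point arrives, its distances to all previous points are revealed. After the $i$-th pair arrives, the algorithm must maintain a perfect matching $M_i$ on $S_i=\{s_1,\dots,s_{2i}\}$; the cost of a matching is the sum of distances between matched points. The recourse is the maximum number of edges of $M_{i}$ deleted when passing to $M_{i+1}$ (any number of edges may be added). Against an oblivious adversary the sequence is fixed in advance (unknown to the algorithm), and the algorithm has expected competitive ratio $c$ if $\mathbb{E}[\mathrm{Cost}(M_i)]\le c\cdot\mathrm{OPT}(S_i)$ for every $i$, where $\mathrm{OPT}(S_i)$ is the minimum cost of a perfect matching on $S_i$. The aspect ratio $\Phi$ is the ratio of maximum to minimum nonzero distance among the points; a metric has doubling dimension $\mathrm{ddim}$ if every ball of radius $2r$ can be covered by $2^{\mathrm{ddim}}$ balls of radius $r$. *)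

(* Defs.v *)
From mathcomp Require Import all_boot all_order all_algebra.
From mathcomp Require Import all_classical all_reals all_analysis.

Set Implicit Arguments.
Unset Strict Implicit.
Unset Printing Implicit Defensive.

Import Order.TTheory GRing.Theory Num.Theory.
Local Open Scope ring_scope.

Definition perfect_matching m (M : {set {set 'I_m}}) : bool :=
  finset.partition M [set: 'I_m]%SET && [forall e in M, #|e| == 2].

(* Each edge {j, k} is counted once, as the ordered pair with j < k. *)
Definition cost (R : realType) m (D : 'M[R]_m) (M : {set {set 'I_m}}) : R :=
  \sum_(j < m) \sum_(k < m | (j < k)%N && ([set j; k]%SET \in M)) D j k.

(* The infimum ranges over a finite set, which is nonempty when m is even, so
   that it is then a minimum. *)
Definition opt (R : realType) m (D : 'M[R]_m) : R :=
  inf [set cost D M | M in [set M | perfect_matching M]]%classic.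

Fact leq_doubleS i : (i.*2 <= i.+1.*2)%N.
Proof. by rewrite leq_double. Qed.

(* The edges of M (on the first i pairs) that are not in M' (on the first i.+1
   pairs). *)
Definition deleted_edges i (M : {set {set 'I_(i.*2)}})
    (M' : {set {set 'I_(i.+1.*2)}}) : {set {set 'I_(i.*2)}} :=
  [set e in M | (widen_ord (leq_doubleS i) @: e)%SET \notin M']%SET.

Definition max_dist (R : realType) m (D : 'M[R]_m) : R :=
  \big[Num.max/0]_(p : 'I_m * 'I_m) D p.1 p.2.

Definition min_nonzero_dist (R : realType) m (D : 'M[R]_m) : R :=
  \big[Num.min/max_dist D]_(p : 'I_m * 'I_m | D p.1 p.2 != 0) D p.1 p.2.

(* If all distances are 0 this is 0 / 0 = 0, and then ln (aspect_ratio D) = 0. *)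
Definition aspect_ratio (R : realType) m (D : 'M[R]_m) : R :=
  max_dist D / min_nonzero_dist D.

Definition has_doubling_dim (R : realType) (X : metricType R) (ddim : R) : Prop :=
  forall (x : X) (r : R), 0 < r ->
  exists2 c : seq X, (size c)%:R <= 2 `^ ddim &
    (ball x (2 * r) `<=` \bigcup_(y in [set` c]) ball y r)%classic.

(* The distances revealed once the first i pairs of s have arrived. *)
Definition revealed (R : realType) (X : metricType R) (s : nat -> X) (i : nat)
    : 'M[R]_(i.*2) :=
  \matrix_(j, k) mdist (s j) (s k).

(* A randomized algorithm is a random deterministic online algorithm: given the
   outcome w of its coins, the matching after i pairs is a function of the
   distances revealed so far only (earlier matchings are determined by w and by
   the upper-left submatrices). *)
Record randomized_algorithm (R : realType) d (Omega : measurableType d) :=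
  RandomizedAlgorithm {
    output :> Omega -> forall i, 'M[R]_(i.*2) -> {set {set 'I_(i.*2)}};
    output_perfect : forall w i D, perfect_matching (output w (i := i) D);
    output_measurable : forall i (D : 'M[R]_(i.*2)) (M : {set {set 'I_(i.*2)}}),
      measurable [set w | output w D = M]%classic
  }.

(* The matching after the i-th pair of s. *)
Definition matching (R : realType) d (Omega : measurableType d)
    (A : randomized_algorithm R Omega) (X : metricType R) (s : nat -> X)
    (w : Omega) (i : nat) : {set {set 'I_(i.*2)}} :=
  A w i (revealed s i).

Definition recourse (R : realType) d (Omega : measurableType d)
    (A : randomized_algorithm R Omega) (X : metricType R) (s : nat -> X)
    (n : nat) (w : Omega) : nat :=
  \max_(i < n) #|deleted_edges (matching A s w i) (matching A s w i.+1)|.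

(* The adversary is oblivious: s does not depend on w. *)
Definition expected_competitive (R : realType) d (Omega : measurableType d)
    (P : probability Omega R) (A : randomized_algorithm R Omega)
    (X : metricType R) (s : nat -> X) (n : nat) (c : R) : Prop :=
  forall i, (i <= n)%N ->
    ('E_P[fun w => cost (revealed s i) (matching A s w i)]
       <= (c * opt (revealed s i))%:E)%E.

(* Main.v *)
(** A single algorithm satisfies both recourse bounds.

Clustering. At scale 2^k take the greedy net, in order of arrival, with separation 2^(k-1). Every net point carves the ball of a random radius in [2^(k-1), 2^k] out of the points not captured by earlier net points, so that clusters never change when points arrive. The radius is governed by a truncated geometric number of steps plus a uniform offset common to all net points. The truncation is logarithmic in the color of the net point in a greedy coloring of nearby net points; as there are 2^O(ddim) colors, two points at distance d are separated at scale 2^k with probability O(ddim d / 2^k), although ddim is not known. The classes at level k are the intersections of clusters over all scales from 2^k on.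

Matching. Keep every class C, with parent P one level higher, crossed by at most max(1, 2|C| - |P|) edges. Cost: if two matched points part at level k, one of their classes is light (2|C| <= |P|), hence crossed exactly once, hence of odd size, hence crossed by every perfect matching; so the cost is at most a constant times the sum, over the edges of any perfect matching and over the O(log Phi) relevant levels at which they are separated, of the scale. Recourse: after matching the new pair together, every violated class is repaired by replacing two edges that leave it by one edge inside and one outside, and this crosses no other class more often than before. Violations occur only at levels at which the class of a new point at least doubles, of which there are O(log n), and at most the number of relevant levels. *)

Require Import Defs.
From mathcomp Require Import all_boot all_order all_algebra.
From mathcomp Require Import all_classical all_reals all_analysis.
From mathcomp Require Import measurable_realfun zify ring lra.
Set Implicit Arguments.
Unset Strict Implicit.
Unset Printing Implicit Defensive.
Import Order.TTheory GRing.Theory Num.Theory.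

(** * Matchings crossing a laminar family *)

(** Matchings are handled as fixed-point-free involutions, with values constrained only below [m],
    so that they extend easily when two points arrive. *)
Definition fun_matching (m : nat) (mu : nat -> nat) : Prop :=
  forall x, x < m -> [/\ mu x < m, mu (mu x) = x & mu x != x].

Definition psize (m : nat) (C : pred nat) : nat := \sum_(x < m) C x.

(** A crossing edge has exactly one end in [C], so counting these ends counts edges. *)
Definition crossings (m : nat) (mu : nat -> nat) (C : pred nat) : nat :=
  \sum_(x < m) (C x && ~~ C (mu x)).

Lemma psize_eq m (C C' : pred nat) : C =1 C' -> psize m C = psize m C'.
Proof. by move=> e; apply: eq_bigr => x _; rewrite e. Qed.

Lemma crossings_eq m mu (C C' : pred nat) :
  C =1 C' -> crossings m mu C = crossings m mu C'.
Proof. by move=> e; apply: eq_bigr => x _; rewrite !e. Qed.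

Lemma leq_crossings_psize m mu C : crossings m mu C <= psize m C.
Proof. by apply: leq_sum => x _; case: (C x) => //=; apply: leq_b1. Qed.

Lemma psize_card m (C : pred nat) : psize m C = #|[pred x : 'I_m | C x]|.
Proof. by rewrite -sum1_card [RHS]big_mkcond; apply: eq_bigr => x _; rewrite inE; case: (C x). Qed.

Lemma leq_psize m (C : pred nat) : psize m C <= m.
Proof. by rewrite psize_card -[leqRHS](card_ord m) max_card. Qed.

Lemma leq_psize_sub m (C C' : pred nat) :
  (forall x, C x -> C' x) -> psize m C <= psize m C'.
Proof. by move=> h; apply: leq_sum => x _; move: (h x); case: (C x) => // ->. Qed.

Lemma psizeD_disjoint m (C C' D : pred nat) :
  (forall x, C x -> D x) -> (forall x, C' x -> D x) ->
  (forall x, C x -> ~~ C' x) -> psize m C + psize m C' <= psize m D.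
Proof.
move=> h h' d; rewrite -big_split; apply: leq_sum => x _ /=.
move: (h x) (h' x) (d x); case: (C x) => /=; case: (C' x) => //.
- by move=> _ _ /(_ isT).
- by move=> ->.
- by move=> _ ->.
Qed.

(** * Exchanging two edges of a matching *)

Section Uncross.
Variables (m : nat) (mu : nat -> nat) (a b : nat).
Hypotheses (mm : fun_matching m mu) (am : a < m) (bm : b < m).
Hypotheses (ab : a != b) (mab : mu a != b).

Definition uncross (x : nat) : nat :=
  if x == a then b else if x == b then a
  else if x == mu a then mu b else if x == mu b then mu a else mu x.

Let mua := let: And3 h _ _ := mm am in h.
Let mub := let: And3 h _ _ := mm bm in h.
Let muKa : mu (mu a) = a. Proof. by case: (mm am). Qed.
Let muKb : mu (mu b) = b. Proof. by case: (mm bm). Qed.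
Let nmua : mu a != a. Proof. by case: (mm am). Qed.
Let nmub : mu b != b. Proof. by case: (mm bm). Qed.
Let mba : mu b != a. Proof. by apply: contra mab => /eqP <-; rewrite muKb. Qed.
Let mumu : mu a != mu b.
Proof. by apply: contra ab => /eqP e; rewrite -muKa e muKb. Qed.

Let uncross_a : uncross a = b. Proof. by rewrite /uncross eqxx. Qed.
Let uncross_b : uncross b = a.
Proof. by rewrite /uncross eqxx eq_sym (negbTE ab). Qed.
Let uncross_mua : uncross (mu a) = mu b.
Proof. by rewrite /uncross (negbTE nmua) (negbTE mab) eqxx. Qed.
Let uncross_mub : uncross (mu b) = mu a.
Proof.
by rewrite /uncross (negbTE mba) (negbTE nmub) eq_sym (negbTE mumu) eqxx.
Qed.
Let uncross_other x : x != a -> x != b -> x != mu a -> x != mu b ->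
  uncross x = mu x.
Proof. by rewrite /uncross; do 4!move=> /negbTE ->. Qed.

Lemma uncross_matching : fun_matching m uncross.
Proof.
move=> x xm.
have [->|xa] := eqVneq x a; first by rewrite uncross_a uncross_b eq_sym.
have [->|xb] := eqVneq x b; first by rewrite uncross_b uncross_a.
have [->|xma] := eqVneq x (mu a).
  by rewrite uncross_mua uncross_mub eq_sym.
have [->|xmb] := eqVneq x (mu b); first by rewrite uncross_mub uncross_mua.
have [h1 h2 h3] := mm xm.
have ne y : x != mu y -> mu x != y.
  by move=> h; apply: contra h => /eqP <-; rewrite h2.
have ne' y : x != y -> y < m -> mu x != mu y.
  by move=> h ym; apply: contra h => /eqP e; rewrite -h2 e; case: (mm ym) => _ ->.
rewrite (uncross_other xa) // uncross_other; [by []|exact: ne|exact: ne|..].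
- exact: ne'.
- exact: ne'.
Qed.

(** The four points concerned are split off both sums, and all other terms agree. The terms lost and
    gained are added on opposite sides to avoid subtraction in [nat]. *)
Lemma uncross_sum (g : nat -> nat -> nat) :
  \sum_(x < m) g x (uncross x)
    + (g a (mu a) + g (mu a) a + g b (mu b) + g (mu b) b) =
  \sum_(x < m) g x (mu x)
    + (g a b + g b a + g (mu a) (mu b) + g (mu b) (mu a)).
Proof.
pose A := Ordinal am; pose B := Ordinal bm.
pose A' := Ordinal mua; pose B' := Ordinal mub.
have dec (h : nat -> nat) : \sum_(x < m) h x =
  h a + (h b + (h (mu a) + (h (mu b) +
    \sum_(x < m | [&& x != A, x != B, x != A' & x != B']) h x))).
  rewrite (bigD1 A) //= (bigD1 B) /=; last by rewrite -val_eqE /= eq_sym.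
  rewrite (bigD1 A') /=; last by rewrite -!val_eqE /= nmua mab.
  rewrite (bigD1 B') /=; last by rewrite -!val_eqE /= mba nmub eq_sym mumu.
  by congr (_ + (_ + (_ + (_ + _)))); apply: eq_bigl => x; rewrite -!andbA.
rewrite (dec (fun x => g x (uncross x))) (dec (fun x => g x (mu x))).
rewrite uncross_a uncross_b uncross_mua uncross_mub muKa muKb.
have -> : \sum_(x < m | [&& x != A, x != B, x != A' & x != B']) g x (uncross x)
  = \sum_(x < m | [&& x != A, x != B, x != A' & x != B']) g x (mu x).
  apply: eq_bigr => x /and4P[]; rewrite -!val_eqE /= => *.
  by rewrite uncross_other.
lia.
Qed.

Lemma uncross_changes : \sum_(x < m) (uncross x != mu x) <= 4.
Proof.
have := uncross_sum (fun x y => y != mu x).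
rewrite !muKa !muKb !eqxx [X in _ = X + _]big1; last by move=> x _; rewrite eqxx.
rewrite !addn0 add0n => ->; rewrite -[4]/(1 + 1 + 1 + 1).
by rewrite !leq_add ?leq_b1.
Qed.

(** If [a] and [b] lie on the same side of [C], the new edge between them does not cross [C], and
    when the other new edge does, one of the two old edges did as well. The second alternative is
    symmetric. *)
Lemma crossings_uncross (C : pred nat) : (C a == C b) || (C (mu a) == C (mu b)) ->
  crossings m uncross C <= crossings m mu C.
Proof.
have := uncross_sum (fun x y => C x && ~~ C y).
rewrite -!/(crossings m _ C) => /=.
case: (C a); case: (C b); case: (C (mu a)); case: (C (mu b)) => //= + _; clear; lia.
Qed.

Lemma crossings_uncross_lt (C : pred nat) : C a -> C b -> ~~ C (mu a) -> ~~ C (mu b) ->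
  crossings m uncross C + 2 <= crossings m mu C.
Proof.
have := uncross_sum (fun x y => C x && ~~ C y).
rewrite -!/(crossings m _ C) => /=.
case: (C a); case: (C b); case: (C (mu a)); case: (C (mu b)) => //= + _ _ _ _; clear; lia.
Qed.
End Uncross.

Lemma reindex_matching (A : Type) (idx : A) (op : Monoid.com_law idx) m mu (g : nat -> A) :
  fun_matching m mu -> \big[op/idx]_(x < m) g (mu x) = \big[op/idx]_(x < m) g x.
Proof.
move=> mm.
have lt (x : 'I_m) : mu x < m by case: (mm _ (ltn_ord x)).
pose f x := Ordinal (lt x).
have fK : involutive f.
  by move=> x; apply: val_inj; case: (mm _ (ltn_ord x)) => _ /=.
by rewrite [RHS](reindex_inj (inv_inj fK)).
Qed.

(** The points of [C] matched inside [C] come in pairs. *)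
Lemma odd_crossings m mu C : fun_matching m mu ->
  odd (crossings m mu C) = odd (psize m C).
Proof.
move=> mm.
have -> : psize m C = crossings m mu C + \sum_(x < m) (C x && C (mu x)).
  rewrite -big_split; apply: eq_bigr => x _ /=.
  by case: (C x); case: (C (mu x)).
suff -> : \sum_(x < m) (C x && C (mu x)) =
    (\sum_(x < m) [&& C x, C (mu x) & x < mu x]).*2.
  by rewrite oddD odd_double addbF.
(* Each inner edge is counted at its smaller end, and after reindexing by [mu] at its larger end. *)
rewrite -addnn -{1}(reindex_matching _ (fun x => [&& C x, C (mu x) & x < mu x] : nat) mm).
rewrite -big_split; apply: eq_bigr => x _ /=.
have [_ -> ne] := mm _ (ltn_ord x).
by move: ne; case: ltngtP; rewrite /= ?andbT ?andbF ?addn0 // andbC.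
Qed.

Definition next_level (k : int) : int := (k + 1)%R.

Lemma next_level_ge k : (k <= next_level k)%R.
Proof. by rewrite lerDl. Qed.

(** * Balanced matchings for nested partitions *)

Section Hierarchy.
Variable E : int -> rel nat.
Hypothesis Eref : forall k, reflexive (E k).
Hypothesis Esym : forall k, symmetric (E k).
Hypothesis Etr : forall k, transitive (E k).
Hypothesis Emono : forall k l x y, (k <= l)%R -> E k x y -> E l x y.

Lemma class_eq k x y : E k x y -> E k x =1 E k y.
Proof.
move=> e z; apply/idP/idP => h; last exact: Etr e h.
by apply: Etr h; rewrite Esym.
Qed.

(** For a class [C] with more than half of its parent [P], the bound is the size of [C] minus that
    of its siblings together; truncated subtraction makes it 1 for every other class. *)
Definition cross_bound m k x : nat :=
  maxn 1 (2 * psize m (E k x) - psize m (E (next_level k) x)).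

Definition balanced m mu : Prop :=
  forall k x, x < m -> crossings m mu (E k x) <= cross_bound m k x.

Lemma class_eqS k x y : E k x y -> E (next_level k) x =1 E (next_level k) y.
Proof. by move=> h; apply: class_eq; apply: Emono h; exact: next_level_ge. Qed.

Lemma cross_bound_eq m k x y : E k x y -> cross_bound m k x = cross_bound m k y.
Proof.
move=> e; rewrite /cross_bound (psize_eq m (class_eq e)).
by rewrite (psize_eq m (class_eqS e)).
Qed.

Lemma crossings_witness m mu C : 0 < crossings m mu C ->
  exists2 x, x < m & C x && ~~ C (mu x).
Proof.
rewrite lt0n sum_nat_eq0 negb_forall => /existsP[x].
by rewrite eqb0 negbK; exists x.
Qed.

Lemma crossings_witness2 m mu C : 1 < crossings m mu C -> exists a b,
  [/\ a < m, b < m, a != b, C a && ~~ C (mu a) & C b && ~~ C (mu b)].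
Proof.
have -> : crossings m mu C = psize m (fun x => C x && ~~ C (mu x)) by [].
rewrite psize_card => /card_gt1P[x [y [hx hy xy]]]; exists x, y; split => //.
Qed.

Lemma balancedW m mu : balanced m mu ->
  forall k x, crossings m mu (E k x) <= cross_bound m k x.
Proof.
move=> bal k x; have [->//|] := posnP (crossings m mu (E k x)).
move=> /crossings_witness[y ym /andP[xy _]].
by rewrite (crossings_eq _ _ (class_eq xy)) (cross_bound_eq _ xy) bal.
Qed.

(** Induction on the list [L] of classes that may be violated. Exchanging two edges that leave such
    a class removes two crossings, which is all the excess allowed, and changes at most four
    partners, while no class gains a crossing. *)
Lemma repair m (L : seq (int * nat)) mu : fun_matching m mu ->
  (forall k x, crossings m mu (E k x) <= cross_bound m k x + 2) ->
  (forall k x, x < m -> cross_bound m k x < crossings m mu (E k x) ->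
     exists2 z, (k, z) \in L & E k z x) ->
  exists mu', [/\ fun_matching m mu', balanced m mu' &
    \sum_(x < m) (mu' x != mu x) <= 4 * size L].
Proof.
elim: L mu => [|[k z] L IH] mu mm exc viol.
  exists mu; split => //; last by rewrite big1 // => x _; rewrite eqxx.
  by move=> k x xm; rewrite leqNgt; apply/negP => /(viol _ _ xm)[].
have [ok|bad] := leqP (crossings m mu (E k z)) (cross_bound m k z).
  have [|mu' [mm' bal ch]] := IH mu mm exc.
    move=> l x xm lt; have [w] := viol l x xm lt.
    rewrite inE => /orP[/eqP[? ?]|]; last by exists w.
    subst l w => e; move: lt; rewrite -(crossings_eq _ _ (class_eq e)).
    by rewrite -(cross_bound_eq _ e) ltnNge ok.
  by exists mu'; split => //; apply: leq_trans ch _; rewrite leq_mul2l leqnSn orbT.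
(* The bound is at least 1, so two edges leave a violated class. *)
have gt1 : 1 < crossings m mu (E k z).
  by apply: leq_ltn_trans bad; rewrite leq_max.
have [a [b [am bm ab /andP[za zma] /andP[zb zmb]]]] := crossings_witness2 gt1.
have mab : mu a != b by apply: contra zma => /eqP ->.
have mm1 := uncross_matching mm am bm ab mab.
have Eab : E k a b by apply: Etr zb; rewrite Esym.
(* A class of level at least [k] contains both or neither of [a] and [b]. A class of lower level
   lies inside the class of [z], and then misses [mu a] and [mu b], or is disjoint from it, and then
   misses [a] and [b]. *)
have mono l x : crossings m (uncross mu a b) (E l x) <= crossings m mu (E l x).
  apply: crossings_uncross => //.
  have [kl|lk] := leP k l.
    have Elab := Emono kl Eab.
    have -> : E l x a = E l x b; last by rewrite eqxx.
    apply/idP/idP => h; first exact: Etr Elab.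
    by apply: Etr h _; rewrite Esym.
  have [h|nh] := boolP (E k z x).
    have nE y : ~~ E k z y -> E l x y = false.
      move=> h'; apply/negbTE; apply: contra h' => h'; apply: Etr h _.
      by apply: Emono h'; exact: ltW.
    by rewrite (nE _ zma) (nE _ zmb) eqxx orbT.
  have nE y : E k z y -> E l x y = false.
    move=> zy; apply/negbTE; apply: contra nh => xy; apply: (Etr zy).
    by rewrite Esym; apply: Emono xy; exact: ltW.
  by rewrite (nE _ za) (nE _ zb) eqxx.
have [||mu' [mm' bal ch]] := IH (uncross mu a b) mm1.
- by move=> l x; apply: leq_trans (mono l x) _.
- move=> l x xm lt; have [w] := viol l x xm (leq_trans lt (mono l x)).
  rewrite inE => /orP[/eqP[? ?]|]; last by exists w.
  subst l w => e; move: lt.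
  rewrite -(crossings_eq _ _ (class_eq e)) -(cross_bound_eq _ e).
  have := crossings_uncross_lt mm am bm ab mab za zb zma zmb.
  have := exc k z; lia.
exists mu'; split => //.
have := uncross_changes mm am bm ab mab.
have : \sum_(x < m) (mu' x != mu x) <= \sum_(x < m) (mu' x != uncross mu a b x)
   + \sum_(x < m) (uncross mu a b x != mu x).
  rewrite -big_split; apply: leq_sum => x _ /=.
  case: (eqVneq (mu' x) (mu x)) => //= ne.
  by case: (eqVneq (mu' x) (uncross mu a b x)) => //= <-; rewrite ne.
move: ch; rewrite /=; lia.
Qed.

Definition extend m (mu : nat -> nat) x : nat :=
  if x < m then mu x else if x == m then m.+1 else m.

Lemma extend_last m mu : extend m mu m = m.+1.
Proof. by rewrite /extend ltnn eqxx. Qed.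

Lemma extend_lastS m mu : extend m mu m.+1 = m.
Proof. by rewrite /extend ltnNge leqnSn gtn_eqF. Qed.

Lemma extend_matching m mu : fun_matching m mu -> fun_matching m.+2 (extend m mu).
Proof.
move=> mm x; rewrite ltnS leq_eqVlt => /orP[/eqP->|].
  by rewrite extend_lastS extend_last ltnS leqnSn ltn_eqF.
rewrite ltnS leq_eqVlt => /orP[/eqP->|xm].
  by rewrite extend_last extend_lastS ltnSn gtn_eqF.
rewrite /extend xm; have [h -> ne] := mm _ xm; rewrite h; split => //.
exact: leq_trans h (leq_trans (leqnSn _) (leqnSn _)).
Qed.

Lemma psizeSS m C : psize m.+2 C = psize m C + C m + C m.+1.
Proof. by rewrite /psize !big_ord_recr. Qed.

Lemma crossings_extend m mu C : fun_matching m mu ->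
  crossings m.+2 (extend m mu) C = crossings m mu C + (C m != C m.+1).
Proof.
move=> mm; rewrite /crossings !big_ord_recr /= extend_last extend_lastS.
have -> : \sum_(x < m) (C x && ~~ C (extend m mu x)) =
          \sum_(x < m) (C x && ~~ C (mu x)).
  by apply: eq_bigr => x _; rewrite /extend ltn_ord.
by rewrite -addnA; case: (C m); case: (C m.+1).
Qed.

(** Sizes count the points present before the pair arrives. The second conjunct excludes the levels,
    possibly infinitely many, at which a new point meets no old one. *)
Definition doubling m k p : bool :=
  (2 * psize m (E k p) <= psize m (E (next_level k) p)) &&
  (0 < psize m (E (next_level k) p)).

Definition heavy m k x : bool :=
  psize m (E (next_level k) x) < 2 * psize m (E k x).

Lemma leq_psizeS m k x : psize m (E k x) <= psize m (E (next_level k) x).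
Proof. by apply: leq_psize_sub => y; apply: Emono; exact: next_level_ge. Qed.

Lemma psize_siblings m k x y : E (next_level k) x y -> ~~ E k x y ->
  psize m (E k x) + psize m (E k y) <= psize m (E (next_level k) x).
Proof.
move=> xy nxy; apply: psizeD_disjoint.
- by move=> z; apply: Emono; exact: next_level_ge.
- by move=> z yz; apply: Etr xy _; apply: Emono yz; exact: next_level_ge.
- by move=> z xz; apply: contra nxy => yz; apply: Etr xz _; rewrite Esym.
Qed.

(** Two disjoint children cannot both hold more than half of their parent. *)
Lemma heavy_uniq m k x y :
  heavy m k x -> heavy m k y -> E (next_level k) x y -> E k x y.
Proof.
move=> hx hy xy; apply/negP => /negP nxy.
have := psize_siblings m xy nxy; move: hx hy.
rewrite /heavy (psize_eq m (class_eq xy)); lia.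
Qed.

(** This locates the violations caused by a new pair: at a doubling level of a new point [p], in the
    class of [p] or in the heavy child of the same parent. *)
Lemma extend_violation m mu k x : fun_matching m mu ->
  (forall k x, crossings m mu (E k x) <= cross_bound m k x) ->
  cross_bound m.+2 k x < crossings m.+2 (extend m mu) (E k x) ->
  exists p, [/\ p \in [:: m; m.+1], E (next_level k) x p, doubling m k p &
    E k x p || heavy m k x].
Proof.
move=> mm bal; rewrite crossings_extend // /cross_bound !psizeSS.
have sub p : E k x p -> E (next_level k) x p by apply: Emono; exact: next_level_ge.
have := bal k x; have := leq_crossings_psize m mu (E k x).
have := leq_psizeS m k x; rewrite /cross_bound.
move=> h1 h2 h3 h4.
have light p : E k x p -> ~~ heavy m k x -> 0 < psize m (E k x) ->
    doubling m k p && E (next_level k) x p.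
  move=> e; rewrite /heavy /doubling -(psize_eq m (class_eq e)).
  by rewrite -(psize_eq m (class_eqS e)) sub // andbT; lia.
have hv p : E (next_level k) x p -> ~~ E k x p -> heavy m k x -> doubling m k p.
  move=> e ne; have := psize_siblings m e ne; rewrite /heavy /doubling.
  by rewrite -(psize_eq m (class_eq e)); lia.
(* A light class was crossed at most once, so a violation needs an old crossing together with the
   new edge. The new end inside the class then sees a class at most half of its parent. *)
have [H|L] := boolP (heavy m k x); last first.
  have c1 : crossings m mu (E k x) <= 1 by move: L; rewrite /heavy; lia.
  have a0 : 0 < psize m (E k x) by lia.
  have [e1|n1] := boolP (E k x m).
    by exists m; have /andP[-> ->] := light _ e1 L a0; rewrite inE eqxx e1.
  have [e2|n2] := boolP (E k x m.+1).
    by exists m.+1; have /andP[-> ->] := light _ e2 L a0; rewrite !inE eqxx orbT e2.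
  by move: h4; rewrite (negbTE n1) (negbTE n2) /=; lia.
(* A new point that joins the parent outside a heavy class belongs to a sibling with less than half
   of the parent, so its level is doubling. *)
have [/andP[e1 n1]|m1] := boolP (E (next_level k) x m && ~~ E k x m).
  by exists m; rewrite inE eqxx orbT hv.
have [/andP[e2 n2]|m2] := boolP (E (next_level k) x m.+1 && ~~ E k x m.+1).
  by exists m.+1; rewrite !inE eqxx !orbT hv.
(* Otherwise every new point of the parent lies in the class and raises twice its size minus that of
   the parent by one, which pays for the new crossing. *)
move: h4 H m1 m2 (sub m) (sub m.+1); rewrite /heavy.
case: (E k x m); case: (E (next_level k) x m); case: (E k x m.+1);
  case: (E (next_level k) x m.+1) => //=; lia.
Qed.

(** The bound drops by 2 only if both new points join siblings of the class, and then the new edge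
    does not cross it. In the other cases the excess is at most 1. *)
Lemma extend_excess m mu k x : fun_matching m mu ->
  (forall k x, crossings m mu (E k x) <= cross_bound m k x) ->
  crossings m.+2 (extend m mu) (E k x) <= cross_bound m.+2 k x + 2.
Proof.
move=> mm bal; rewrite crossings_extend // /cross_bound !psizeSS.
have sub p : E k x p -> E (next_level k) x p by apply: Emono; exact: next_level_ge.
have := bal k x; rewrite /cross_bound.
move: (sub m) (sub m.+1).
case: (E k x m); case: (E (next_level k) x m); case: (E k x m.+1);
  case: (E (next_level k) x m.+1) => //=; try (by move=> /(_ isT)); try (by move=> _ /(_ isT)); lia.
Qed.

(** Each doubling level of a new point puts two classes on the repair list, its own and the heavy
    child [h k p] of its parent. With four changed partners per class this gives the factor 8. *)
Lemma insert_pair m mu (S : nat -> seq int) : fun_matching m mu ->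
  balanced m mu ->
  (forall p k, p \in [:: m; m.+1] -> doubling m k p -> k \in S p) ->
  exists mu', [/\ fun_matching m.+2 mu', balanced m.+2 mu' &
    \sum_(x < m) (mu' x != mu x) <= 8 * (size (S m) + size (S m.+1))].
Proof.
move=> mm bal hS; have {}bal := balancedW bal.
pose h k p := if [pick x : 'I_m.+2 | heavy m k x && E (next_level k) x p] is Some x
              then x : nat else 0.
pose Lp p := [seq (k, p) | k <- S p] ++ [seq (k, h k p) | k <- S p].
have [||mu' [mm' bal' ch]] := @repair m.+2 (Lp m ++ Lp m.+1) _ (extend_matching mm).
- by move=> k x; apply: extend_excess.
- move=> k x xm /(extend_violation mm bal)[p [pin xp dp]].
  have kS := hS _ _ pin dp.
  have sub z : (k, z) \in Lp p -> (k, z) \in Lp m ++ Lp m.+1.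
    move=> hz; rewrite [_ \in _ ++ _]mem_cat.
    by move: pin hz; rewrite !in_cons in_nil orbF => /orP[]/eqP-> ->; rewrite ?orbT.
  move=> /orP[e|hx].
    exists p; last by rewrite Esym.
    by apply: sub; rewrite mem_cat map_f.
  exists (h k p); first by apply: sub; rewrite mem_cat (map_f (fun k => (k, h k p))) ?orbT.
  rewrite /h; case: pickP => [y /andP[hy yp]|/(_ (Ordinal xm))]; last by rewrite /= hx xp.
  by apply: (heavy_uniq hy hx); apply: Etr yp _; rewrite Esym.
exists mu'; split => //.
have : \sum_(x < m) (mu' x != mu x) <=
       \sum_(x < m.+2) (mu' x != extend m mu x).
  rewrite !big_ord_recr /= -addnA; apply: leq_trans (leq_addr _ _).
  by apply: leq_sum => x _; rewrite /extend ltn_ord.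
move: ch; rewrite !size_cat !size_map; lia.
Qed.

(** The charging argument for the cost. An edge of [mu] that parts at level [k] has an end in a
    light class. As [mu] crosses this class exactly once, its size is odd, so [nu] crosses it too,
    and the end is charged to such a crossing of [nu]. *)
Lemma split_count m mu nu k : fun_matching m mu -> fun_matching m nu ->
  balanced m mu ->
  \sum_(x < m) (~~ E k x (mu x) && E (next_level k) x (mu x)) <=
  2 * \sum_(x < m) ~~ E k x (nu x).
Proof.
move=> mm nn bal.
pose light x := ~~ heavy m k x.
pose X x := ~~ E k x (mu x) && E (next_level k) x (mu x).
(* By [heavy_uniq] one of the two ends is light; the factor 2 accounts for the other end. *)
have le1 : \sum_(x < m) X x <= 2 * \sum_(x < m) (X x && light x).
  rewrite mul2n -addnn -{2}(reindex_matching _ (fun x => X x && light x : nat) mm).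
  rewrite -big_split; apply: leq_sum => x _ /=.
  have [Xx|] := boolP (X x) => //=.
  have [_ muK _] := mm _ (ltn_ord x).
  have -> : X (mu x) by move: Xx; rewrite /X muK !(Esym _ (mu x) x).
  have [//|/negbNE hx] := boolP (light x).
  have [//|/negbNE hy] := boolP (light (mu x)).
  by case/andP: Xx => /negP h e; case: h; apply: heavy_uniq hx hy e.
apply: leq_trans le1 _; rewrite leq_mul2l /=.
have one x : x < m -> X x && light x -> crossings m mu (E k x) = 1.
  move=> xm /andP[/andP[nx _] lx].
  have le : crossings m mu (E k x) <= 1.
    apply: leq_trans (bal k x xm) _; move: lx; rewrite /light /heavy /cross_bound.
    lia.
  apply/eqP; rewrite eqn_leq le /= /crossings (bigD1 (Ordinal xm)) //=.
  by rewrite Eref nx.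
have wit x : x < m -> X x && light x ->
    exists2 y : 'I_m, E k x y & ~~ E k y (nu y).
  move=> xm Xx; have : odd (crossings m nu (E k x)).
    by rewrite odd_crossings // -(odd_crossings _ mm) one.
  case: (posnP (crossings m nu (E k x))) => [->//|].
  move=> /crossings_witness[y ym /andP[xy nxy]] _; exists (Ordinal ym) => //=.
  by apply: contra nxy; apply: Etr xy.
pose phi (x : 'I_m) : 'I_m :=
  if [pick y : 'I_m | E k x y && ~~ E k y (nu y)] is Some y then y else x.
have phiP (x : 'I_m) : X x && light x ->
    E k x (phi x) && ~~ E k (phi x) (nu (phi x)).
  move=> Xx; rewrite /phi; case: pickP => [y //|no].
  by have [y h1 h2] := wit x (ltn_ord x) Xx; move: (no y); rewrite h1 h2.
have -> : \sum_(x < m) (X x && light x) = psize m (fun x => X x && light x) by [].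
have -> : \sum_(x < m) ~~ E k x (nu x) = psize m (fun x => ~~ E k x (nu x)) by [].
rewrite !psize_card.
set A := [pred x : 'I_m | X x && light x].
(* Equal charges put [x] and [y] into one class, which would then be crossed twice unless
   [x = y]. *)
have inj : {in A &, injective phi}.
  move=> x y; rewrite !inE => Xx Xy e.
  have /andP[h1 _] := phiP x Xx; have /andP[h2 _] := phiP y Xy.
  have xy : E k x y by apply: Etr h1 _; rewrite e Esym.
  have := one x (ltn_ord x) Xx.
  have [//|ne] := eqVneq x y.
  rewrite /crossings (bigD1 x) //= (bigD1 y) 1?eq_sym //=.
  have -> : ~~ E k x (mu x) by move: Xx => /andP[/andP[]].
  have nyy : ~~ E k y (mu y) by move: Xy => /andP[/andP[]].
  have -> : ~~ E k x (mu y).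
    by apply: contra nyy; apply: Etr; rewrite Esym.
  by rewrite Eref xy.
rewrite -(card_in_image inj); apply: subset_leq_card; apply/fintype.subsetP => y.
by move=> /fintype.imageP[x]; rewrite inE => Xx ->; rewrite inE; case/andP: (phiP x Xx).
Qed.
End Hierarchy.

(** Every counted step at least doubles a positive size, except the step that leaves 0, which the
    factor 2 on the right pays for. *)
Lemma count_doublings (c : nat -> nat) T : (forall t, c t <= c t.+1) ->
  2 ^ count (fun t => (2 * c t <= c t.+1) && (0 < c t.+1)) (iota 0 T)
    <= maxn 1 (2 * c T).
Proof.
move=> mono; set f := fun t => _.
elim: T => [|T IH]; first by rewrite /= expn0 leq_max.
rewrite -{1}[T.+1]addn1 iotaD count_cat /= addn0 add0n expnD.
have := mono T; move: IH; move: (2 ^ count f (iota 0 T)) => r.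
have [/andP[h1 h2]|_] := boolP (f T).
  by rewrite expn1; lia.
by rewrite expn0; lia.
Qed.

(** * Fair bits and random radii *)

Section FiberMeasurable.
Context d (T : measurableType d).
Local Open Scope classical_set_scope.

(** Measurability of maps to discrete sets, stated without a sigma-algebra on the target. *)
Definition fiber_measurable (U : Type) (f : T -> U) : Prop :=
  forall u, measurable [set t | f t = u].

Lemma fiber_measurable_comp (U : finType) (V : Type) (f : T -> U) (g : U -> V) :
  fiber_measurable f -> fiber_measurable (fun t => g (f t)).
Proof.
move=> mf v.
have -> : [set t | g (f t) = v] = \bigcup_(u in [set u | g u = v]) [set t | f t = u].
  by apply/seteqP; split => [t /= e|t [u /= e fu] /=]; [exists (f t)|rewrite fu].
by apply: fin_bigcup_measurable => //; exact: finite_finset.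
Qed.

Lemma fiber_measurable_ffun (I : finType) (U : Type) (f : T -> I -> U) :
  (forall i, fiber_measurable (f ^~ i)) ->
  fiber_measurable (fun t => [ffun i => f t i]).
Proof.
move=> mf u.
have -> : [set t | [ffun i => f t i] = u] =
    \bigcap_(i in setT) [set t | f t i = u i].
  apply/seteqP; split => [t /= <- i _ /=|t h]; first by rewrite ffunE.
  by apply/ffunP => i; rewrite ffunE; apply: h.
apply: fin_bigcap_measurable; first exact: finite_finset.
by move=> i _; exact: mf.
Qed.

Lemma fiber_measurable_pair (U V : Type) (f : T -> U) (g : T -> V) :
  fiber_measurable f -> fiber_measurable g ->
  fiber_measurable (fun t => (f t, g t)).
Proof.
move=> mf mg [u v].
have -> : [set t | (f t, g t) = (u, v)] = [set t | f t = u] `&` [set t | g t = v].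
  by apply/seteqP; split => t /= [-> ->].
exact: measurableI.
Qed.

Lemma fiber_measurable_bool (f : T -> bool) :
  measurable [set t | f t] -> fiber_measurable f.
Proof.
move=> mf [|] //.
have -> : [set t | f t = false] = ~` [set t | f t].
  by apply/seteqP; split => t /=; [move=> ->|move=> /negP/negbTE].
exact: measurableC.
Qed.

Lemma fiber_measurable_cst (U : Type) (u : U) : fiber_measurable (fun _ : T => u).
Proof.
move=> v; have [->|ne] := pselect (u = v).
  by rewrite (_ : [set _ | _] = setT) //; apply/seteqP; split.
by rewrite (_ : [set _ | _] = set0) //; apply/seteqP; split.
Qed.
End FiberMeasurable.

(** * Independent fair bits from one uniform real *)

Section Bits.
Context {R : realType}.
Local Open Scope classical_set_scope.
Local Open Scope ring_scope.

Definition bit (n : nat) (x : R) : bool := odd (Num.truncn (2 ^+ n.+1 * x)).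

Definition bits (x : R) : nat -> bool := bit ^~ x.

Lemma truncn_double (y : R) : 0 <= y -> (Num.truncn (2 * y))./2 = Num.truncn y.
Proof.
move=> y0; have y20 : 0 <= 2 * y by rewrite mulr_ge0.
apply/esym/eqP; rewrite truncn_eq //.
have /andP[] := truncn_itv y20; set k := Num.truncn _.
have : k%:R = (odd k)%:R + 2 * (k./2)%:R :> R.
  by rewrite -natrM -natrD mul2n odd_double_half.
rewrite -!natr1; case: (odd k) => /= ->; lra.
Qed.

Fixpoint bits_val (N : nat) (b : nat -> bool) : nat :=
  if N is n.+1 then (b n + (bits_val n b).*2)%N else 0%N.

Lemma bits_val_truncn N (x : R) : 0 <= x < 1 ->
  bits_val N (bits x) = Num.truncn (2 ^+ N * x).
Proof.
move=> /andP[x0 x1]; elim: N => [|N IH] /=.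
  by apply/esym/eqP; rewrite expr0 mul1r truncn_eq // x0.
rewrite IH -truncn_double ?mulr_ge0 ?exprn_ge0 // mulrA -exprS.
by rewrite odd_double_half.
Qed.

Lemma bits_val_lt N b : (bits_val N b < 2 ^ N)%N.
Proof.
elim: N => //= N; rewrite expnS mul2n; case: (b N) => /=; lia.
Qed.

Lemma bits_val_inj N b b' : bits_val N b = bits_val N b' ->
  forall i, (i < N)%N -> b i = b' i.
Proof.
elim: N => //= N IH e i.
have bN : b N = b' N.
  by have := congr1 odd e; rewrite !oddD !odd_double !addbF; case: (b N); case: (b' N).
rewrite ltnS leq_eqVlt => /orP[/eqP->//|iN]; apply: IH => //.
by move: e; rewrite bN; lia.
Qed.

Lemma eq_bits_val N b b' : (forall i, (i < N)%N -> b i = b' i) ->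
  bits_val N b = bits_val N b'.
Proof.
elim: N => //= N IH e; rewrite e // IH // => i iN.
by apply: e; exact: ltnW.
Qed.

Definition cylinder (N : nat) (b : nat -> bool) : set R :=
  [set x | 0 <= x < 1 /\ forall i, (i < N)%N -> bit i x = b i].

(** Fixing [N] binary digits of [x] fixes the integer part of [2 ^ N * x], which leaves a dyadic
    interval. *)
Lemma cylinderE N b : cylinder N b =
  `[(bits_val N b)%:R / 2 ^+ N, (bits_val N b).+1%:R / 2 ^+ N[%classic.
Proof.
have p : 0 < 2 ^+ N :> R by rewrite exprn_gt0.
apply/seteqP; split => x /=; rewrite in_itv /=.
  move=> [x01 h]; have x0 : 0 <= x by case/andP: x01.
  have := bits_val_truncn N x01; rewrite (@eq_bits_val N _ b) //.
  have y0 : 0 <= 2 ^+ N * x by rewrite mulr_ge0 // ltW.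
  move=> /esym/eqP; rewrite truncn_eq //.
  by rewrite ler_pdivrMr // ltr_pdivlMr // mulrC.
rewrite ler_pdivrMr // ltr_pdivlMr // mulrC => h.
have x0 : 0 <= x.
  rewrite -(pmulr_rge0 x p); case/andP: h => + _.
  by apply: le_trans; rewrite ler0n.
have x1 : x < 1.
  rewrite -(ltr_pM2l p) mulr1; case/andP: h => _ /lt_le_trans; apply.
  by rewrite -natrX ler_nat bits_val_lt.
split; first by rewrite x0.
apply: (@bits_val_inj N); rewrite bits_val_truncn ?x0 //.
by apply/eqP; rewrite truncn_eq // mulr_ge0 // ltW.
Qed.

Definition unif : probability (measurableTypeR R) R := uniform_prob (@ltr01 R).

Lemma unifE (A : set R) : measurable A ->
  unif A = lebesgue_measure (A `&` `[0, 1]%classic).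
Proof.
move=> mA; rewrite /unif /uniform_prob /= /uniform_prob integral_uniform_pdf.
rewrite (eq_integral (cst 1%E)) => [|x].
  by rewrite integral_cst ?mul1e //; apply: measurableI.
rewrite inE /= => -[_]; rewrite in_itv /= /uniform_pdf => ->.
by rewrite subr0 invr1.
Qed.

Lemma unif_itv_le (a b : R) : a <= b -> (unif `[a, b[%classic <= (b - a)%:E)%E.
Proof.
move=> ab; rewrite unifE //.
have : (lebesgue_measure (`[a, b[%classic `&` `[0%R, 1%R]%classic) <= lebesgue_measure `[a, b[%classic)%E.
  by apply: le_measure; rewrite ?inE //; apply: measurableI.
move=> /le_trans; apply; rewrite lebesgue_measure_itv /= lte_fin.
by case: ifP => // _; rewrite lee_fin subr_ge0.
Qed.

Lemma unif_sub_itv (a b : R) : 0 <= a -> a <= b -> b <= 1 -> unif `[a, b[%classic = (b - a)%:E.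
Proof.
move=> a0 ab b1; rewrite unifE // setIidl; last first.
  move=> x /=; rewrite !in_itv /= => /andP[ax xb].
  by rewrite (le_trans a0 ax) (le_trans (ltW xb) b1).
rewrite lebesgue_measure_itv /= lte_fin; case: ltgtP ab => //.
by move=> ->; rewrite subrr.
Qed.

Lemma unif_cylinder N b : unif (cylinder N b) = ((2 ^+ N)^-1)%:E.
Proof.
have p : 0 < 2 ^+ N :> R by rewrite exprn_gt0.
rewrite cylinderE unif_sub_itv.
- by rewrite -mulrBl -natrB // subSnn mul1r.
- by rewrite divr_ge0 // ltW.
- by rewrite ler_pM2r ?invr_gt0 // ler_nat.
- by rewrite ler_pdivrMr // mul1r -natrX ler_nat bits_val_lt.
Qed.

Lemma measurable_cylinder N b : measurable (cylinder N b).
Proof. by rewrite cylinderE. Qed.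

Lemma measurable_bit n : measurable [set x : R | bit n x].
Proof.
have -> : [set x : R | bit n x] =
  \bigcup_(k in [set k | odd k]) `[k%:R / 2 ^+ n.+1, k.+1%:R / 2 ^+ n.+1[%classic.
  have p : 0 < 2 ^+ n.+1 :> R by rewrite exprn_gt0.
  apply/seteqP; split => [x /= h|x [k /= ko]].
    exists (Num.truncn (2 ^+ n.+1 * x)) => //=.
    rewrite in_itv /= ler_pdivrMr // ltr_pdivlMr // mulrC.
    have [x0|x0] := leP 0 x; first by rewrite truncn_itv // mulr_ge0 // ltW.
    by move: h; rewrite /bit truncn_floor leNgt pmulr_rlt0 // x0.
  rewrite in_itv /= ler_pdivrMr // ltr_pdivlMr // mulrC => h.
  rewrite /bit; have /eqP -> : Num.truncn (2 ^+ n.+1 * x) == k => //.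
  by rewrite truncn_eq //; case/andP: h => + _; apply: le_trans; rewrite ler0n.
by apply: bigcup_measurable => k _.
Qed.

Definition ext_bits N (f : {ffun 'I_N -> bool}) (i : nat) : bool :=
  if insub i is Some j then f j else false.

Definition finite_bits U (N : nat) (e : (nat -> bool) -> U) : Prop :=
  forall b b', (forall i, (i < N)%N -> b i = b' i) -> e b = e b'.

Lemma finite_bitsW U N N' (e : (nat -> bool) -> U) : (N <= N')%N ->
  finite_bits N e -> finite_bits N' e.
Proof. by move=> NN h b b' e'; apply: h => i iN; apply: e'; apply: leq_trans NN. Qed.

Lemma ext_bitsE N (b : nat -> bool) i : (i < N)%N ->
  ext_bits [ffun j : 'I_N => b j] i = b i.
Proof. by move=> iN; rewrite /ext_bits insubT ffunE. Qed.

Lemma fiber_measurable_bits U N (e : (nat -> bool) -> U) : finite_bits N e ->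
  fiber_measurable (fun x : R => e (bits x)).
Proof.
move=> fe; pose g (f : {ffun 'I_N -> bool}) := e (ext_bits f).
have -> : (fun x : R => e (bits x)) = (fun x => g [ffun i : 'I_N => bit i x]).
  by apply/funext => x; rewrite /g; apply: fe => i iN; rewrite (ext_bitsE (bits x)).
apply: fiber_measurable_comp; apply: fiber_measurable_ffun => i.
by apply: fiber_measurable_bool; exact: measurable_bit.
Qed.

Definition bits_prob (e : (nat -> bool) -> bool) : R :=
  fine (unif [set x | e (bits x)]).

Lemma bits_probE (e : (nat -> bool) -> bool) N : finite_bits N e ->
  unif [set x | e (bits x)] = (bits_prob e)%:E.
Proof.
move=> fe; rewrite /bits_prob fineK // fin_num_measure //.
exact: (fiber_measurable_bits fe true).
Qed.

(** The cylinders of depth [N] are disjoint and of equal measure. Probabilities of events in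
    finitely many bits become counts, and independence is then proved by bijections. *)
Lemma bits_prob_count (e : (nat -> bool) -> bool) N : finite_bits N e ->
  bits_prob e = #|[set f : {ffun 'I_N -> bool} | e (ext_bits f)]%SET|%:R / 2 ^+ N.
Proof.
move=> fe; apply: EFin_inj; rewrite -(bits_probE fe).
set S := [set f : {ffun 'I_N -> bool} | e (ext_bits f)]%SET.
have mE : measurable [set x : R | e (bits x)] := fiber_measurable_bits fe true.
(* The law lives on [[0, 1]]; the endpoint 1, which is in no cylinder, is negligible. *)
have null : (unif (~` `[0%R, 1%R[%classic) = 0)%E.
  by rewrite probability_setC // unif_sub_itv // subr0 subee.
have -> : unif [set x | e (bits x)] = unif ([set x | e (bits x)] `&` `[0, 1[%classic).
  rewrite (measureDI unif mE (measurable_itv `[0, 1[)) -[RHS]add0e; congr (_ + _)%E.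
  apply/eqP; rewrite eq_le measure_ge0 andbT -null; apply: le_measure; rewrite ?inE.
  - exact: measurableD.
  - exact: measurableC.
  - by move=> x [].
have -> : [set x | e (bits x)] `&` `[0, 1[%classic =
    \bigcup_(f in [set` enum S]) cylinder N (ext_bits f).
  apply/seteqP; split => [x [/= ex]|x [f /=]].
    rewrite in_itv /= => x01; exists [ffun i : 'I_N => bit i x] => /=.
      rewrite mem_enum inE (_ : e _ = e (bits x)) //; apply: fe => i iN.
      by rewrite (ext_bitsE (bits x)).
    by split => // i iN; rewrite (ext_bitsE (bits x)).
  rewrite mem_enum inE => ef [x01 h]; split; last by rewrite /= in_itv.
  by rewrite /= (fe _ _ h).
rewrite measure_fin_bigcup //.
- rewrite -fsbig_seq ?enum_uniq //= (eq_bigr (fun=> ((2 ^+ N)^-1)%:E)); last first.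
    by move=> f _; rewrite unif_cylinder.
  by rewrite sumEFin big_enum /= sumr_const mulr_natl.
- move=> f g _ _ [x [[_ hf] [_ hg]]]; apply/ffunP => i.
  have := hg i (ltn_ord i); rewrite hf // /ext_bits.
  by rewrite !insubT //= => iN; rewrite (_ : Sub _ _ = i) //; apply: val_inj.
- by move=> f _; exact: measurable_cylinder.
Qed.
Definition flip (i : nat) (b : nat -> bool) : nat -> bool :=
  fun j => if j == i then ~~ b j else b j.

Lemma bits_prob_ge0 e : 0 <= bits_prob e.
Proof. by rewrite /bits_prob fine_ge0. Qed.

Lemma bits_prob_le1 e N : finite_bits N e -> bits_prob e <= 1.
Proof.
move=> fe; rewrite -lee_fin -(bits_probE fe).
by apply: probability_le1; exact: (fiber_measurable_bits fe true).
Qed.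

Lemma finite_bits_and N (e e' : (nat -> bool) -> bool) :
  finite_bits N e -> finite_bits N e' -> finite_bits N (fun b => e b && e' b).
Proof. by move=> h h' b b' bb; rewrite (h b b') // (h' b b'). Qed.

Lemma finite_bits_not N (e : (nat -> bool) -> bool) :
  finite_bits N e -> finite_bits N (fun b => ~~ e b).
Proof. by move=> h b b' bb; rewrite (h b b'). Qed.

Lemma bits_probD N (e g : (nat -> bool) -> bool) :
  finite_bits N e -> finite_bits N g ->
  bits_prob e = bits_prob (fun b => e b && g b) + bits_prob (fun b => e b && ~~ g b).
Proof.
move=> fe fg; rewrite (bits_prob_count fe).
rewrite (bits_prob_count (finite_bits_and fe fg)).
rewrite (bits_prob_count (finite_bits_and fe (finite_bits_not fg))).
rewrite -mulrDl -natrD; congr (_%:R / _).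
rewrite -(cardsID [set f : {ffun 'I_N -> bool} | g (ext_bits f)]%SET).
by congr (_ + _)%N; apply: eq_card => f; rewrite !inE // andbC.
Qed.

(** Flipping bit [i] exchanges the outcomes of [e] with that bit set and those with it unset. *)
Lemma bits_prob_half N (e : (nat -> bool) -> bool) i : finite_bits N e ->
  (forall b, e (flip i b) = e b) ->
  bits_prob (fun b => e b && b i) = bits_prob e / 2.
Proof.
move=> fe fl; pose N' := maxn N i.+1.
have {}fe : finite_bits N' e by apply: finite_bitsW fe; rewrite leq_maxl.
have iN : (i < N')%N by rewrite leq_maxr.
have fi : finite_bits N' (fun b => b i) by move=> b b' /(_ _ iN).
rewrite (bits_probD fe fi).
suff -> : bits_prob (fun b => e b && ~~ b i) = bits_prob (fun b => e b && b i).
  by rewrite -mulr2n -[_ *+ 2]mulr_natr mulfK.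
rewrite (bits_prob_count (finite_bits_and fe fi)).
rewrite (bits_prob_count (finite_bits_and fe (finite_bits_not fi))).
congr (_%:R / _).
pose h (f : {ffun 'I_N' -> bool}) : {ffun 'I_N' -> bool} :=
  [ffun j : 'I_N' => if (j : nat) == i then ~~ f j else f j].
have hK : involutive h.
  by move=> f; apply/ffunP => j; rewrite !ffunE; case: eqP => // _; rewrite negbK.
have he f (j : nat) : (j < N')%N -> ext_bits (h f) j = flip i (ext_bits f) j.
  by move=> jN; rewrite /ext_bits insubT ffunE /= /flip insubT.
rewrite -(card_imset _ (inv_inj hK)); apply: eq_card => f.
rewrite -[f in LHS]hK mem_imset; last exact: inv_inj hK.
rewrite !inE (fe _ _ (he f)) fl; congr andb.
by rewrite he // /flip eqxx negbK.
Qed.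

Definition finitary U (e : (nat -> bool) -> U) : Prop := exists N, finite_bits N e.

Lemma finitary_map2 T U V (p : (nat -> bool) -> T) (e : (nat -> bool) -> U)
    (f : T -> U -> V) : finitary p -> finitary e -> finitary (fun b => f (p b) (e b)).
Proof.
move=> [N fp] [N' fe]; exists (maxn N N') => b b' bb.
rewrite (fp b b') ?(fe b b') // => i iN; apply: bb; rewrite leq_max iN ?orbT //.
Qed.

(* 2 ^ max_lead c >= c.+1 ^ 2, so that the truncation probabilities of distinct colors are summable. *)
Definition max_lead (c : nat) : nat := (trunc_log 2 c.+1).+1.*2.

(** [pickle] is injective, so different colors read disjoint sets of bits. *)
Definition bit_index (c i : nat) : nat := pickle (c, i).

Definition ones (c i : nat) (b : nat -> bool) : bool :=
  all (fun j => b (bit_index c j)) (iota 0 i).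

(** The number of leading ones among the bits of color [c]: a geometric variable truncated at
    [max_lead c]. *)
Definition lead (c : nat) (b : nat -> bool) : nat :=
  find (fun i => ~~ b (bit_index c i)) (iota 0 (max_lead c)).

Lemma lead_max c b : (lead c b <= max_lead c)%N.
Proof. by rewrite /lead -[leqRHS](size_iota 0) find_size. Qed.

Lemma leq_lead c i b : (i <= max_lead c)%N -> (i <= lead c b)%N = ones c i b.
Proof.
move=> iK; rewrite leqNgt /lead -has_take_leq ?size_iota //.
by rewrite take_iota (minn_idPl iK) has_predC negbK.
Qed.

Lemma onesS c i b : ones c i.+1 b = ones c i b && b (bit_index c i).
Proof. by rewrite /ones -addn1 iotaD all_cat /= andbT add0n. Qed.

Lemma finitary_ones c i : finitary (ones c i).
Proof.
elim: i => [|i IH]; first by exists 0%N.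
have -> : ones c i.+1 = (fun b => andb (ones c i b) (b (bit_index c i))).
  by apply/funext => b; rewrite onesS.
apply: finitary_map2 => //; exists (bit_index c i).+1 => b b'; exact.
Qed.

Lemma finitary_lead c : finitary (lead c).
Proof.
have [N h] : finitary (fun b => [ffun i : 'I_(max_lead c) => b (bit_index c i)]).
  exists (\max_(i < max_lead c) (bit_index c i).+1)%N => b b' bb.
  apply/ffunP => i; rewrite !ffunE; apply: bb.
  exact: (leq_bigmax (F := fun i : 'I_(max_lead c) => (bit_index c i).+1)).
exists N => b b' bb; rewrite /lead; apply: eq_in_find => i.
rewrite mem_iota add0n => /= iK.
by have /ffunP /(_ (Ordinal iK)) := h _ _ bb; rewrite !ffunE /= => ->.
Qed.

Definition color_free (c : nat) U (e : (nat -> bool) -> U) : Prop :=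
  forall i b, e (flip (bit_index c i) b) = e b.

Lemma color_free_lead c c' : c != c' -> color_free c (lead c').
Proof.
move=> ne i b; apply: eq_in_find => j _; rewrite /flip ifF //.
apply: contra_neqF ne => /eqP/(congr1 (@unpickle (nat * nat)%type)).
by rewrite !pickleK => -[->].
Qed.

Lemma bits_prob_ones c (e : (nat -> bool) -> bool) i :
  finitary e -> color_free c e ->
  bits_prob (fun b => e b && ones c i b) = bits_prob e / 2 ^+ i.
Proof.
move=> fe ce; elim: i => [|i IH].
  by rewrite expr0 divr1; congr bits_prob; apply/funext => b; rewrite andbT.
have [N fN] : finitary (fun b => e b && ones c i b).
  exact: finitary_map2 fe (finitary_ones c i).
rewrite (_ : (fun b => _) = (fun b => (e b && ones c i b) && b (bit_index c i))).
  rewrite (bits_prob_half fN).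
    by rewrite IH exprS invfM -mulrA [X in _ * X]mulrC.
  move=> b; rewrite ce; congr andb.
  apply: eq_in_all => j; rewrite mem_iota add0n => /= ji.
  rewrite /flip ifF //; apply/negbTE; apply: contraTneq ji.
  by move=> /(congr1 (@unpickle (nat * nat)%type)); rewrite !pickleK => -[->]; rewrite ltnn.
by apply/funext => b; rewrite onesS andbA.
Qed.

(* Memorylessness up to truncation: a net point that reaches step g.-1 reaches step g with probability 1/2. *)
Lemma bits_prob_lead c g (e : (nat -> bool) -> bool) : finitary e ->
  color_free c e ->
  bits_prob (fun b => e b && (g.-1 <= lead c b)%N) <=
  2 * bits_prob (fun b => e b && (g <= lead c b)%N) + (2 ^+ max_lead c)^-1.
Proof.
move=> fe ce; have := bits_prob_ge0; move=> p0.
have [N fN] := fe; have p1 := bits_prob_le1 fN.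
have q0 n : 0 <= ((2 ^+ n)^-1 : R) by rewrite invr_ge0 exprn_ge0.
case: g => [|g] /=.
  have := p0 (fun b => e b && (0 <= lead c b)%N); have := q0 (max_lead c); lra.
have [gK|Kg] := leqP g (max_lead c); last first.
  rewrite [X in X <= _](_ : _ = 0).
    by rewrite addr_ge0 // mulr_ge0.
  rewrite (_ : (fun b => _) = (fun=> false)) /bits_prob.
    by rewrite (_ : [set x | _] = set0) ?measure0 //; apply/seteqP; split.
  apply/funext => b; rewrite leqNgt (leq_ltn_trans (lead_max _ _) Kg) andbF //.
rewrite (_ : (fun b => e b && (g <= lead c b)%N) = (fun b => e b && ones c g b)); last first.
  by apply/funext => b; rewrite leq_lead.
rewrite bits_prob_ones //.
have [gK'|] := ltnP g (max_lead c).
  rewrite (_ : (fun b => e b && (g < lead c b)%N) = (fun b => e b && ones c g.+1 b)); last first.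
    by apply/funext => b; rewrite leq_lead.
  rewrite bits_prob_ones // exprS invfM mulrCA mulVKf //; have := q0 (max_lead c); lra.
(* At the truncation step the event on the right is impossible, and the error term alone bounds the
   left-hand side. *)
move=> Kg; have -> : g = max_lead c by apply/eqP; rewrite eqn_leq gK Kg.
rewrite -[leLHS]add0r lerD //; first by rewrite mulr_ge0.
by rewrite ler_piMl // q0.
Qed.

(** * Random radii and the probability of separating two points *)

Notation RxR := (measurableTypeR R * measurableTypeR R)%type.

Definition coins : probability RxR R := (unif \x unif)%E.

(* The offset is clipped because the recourse bound must hold for all outcomes, including those of probability 0. *)
Definition clip (u : R) : R := Num.max 0 (Num.min u 1).

Lemma clip_itv u : 0 <= clip u <= 1.
Proof. by rewrite /clip le_max lexx ge_max ler01 ge_min lexx orbT. Qed.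

Definition reach (c : nat) (w : RxR) : R := (lead c (bits w.1))%:R + clip w.2.

Lemma measurable_clip_ge a : measurable [set u : R | a <= clip u].
Proof.
have [a0|a0] := leP a 0.
  rewrite (_ : [set _ | _] = setT) //; apply/seteqP; split => // u _ /=.
  by apply: le_trans a0 _; case/andP: (clip_itv u).
have [a1|a1] := leP a 1; last first.
  rewrite (_ : [set _ | _] = set0) //; apply/seteqP; split => // u /= h.
  by move: (clip_itv u) => /andP[_]; rewrite leNgt (lt_le_trans a1 h).
rewrite (_ : [set _ | _] = `[a, +oo[%classic) //.
apply/seteqP; split => u /=; rewrite in_itv /= andbT /clip le_max le_min a1 andbT.
  by rewrite leNgt a0.
by move=> ->; rewrite orbT.
Qed.

Lemma measurable_reach_ge c a : measurable [set w : RxR | a <= reach c w].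
Proof.
have -> : [set w : RxR | a <= reach c w] =
  \bigcup_(g in setT) ([set x | lead c (bits x) = g] `*` [set u | a - g%:R <= clip u]).
  apply/seteqP; split => [[x u] /= h|[x u] [g _ [/= <-]]].
    by exists (lead c (bits x)) => //=; split => //=; rewrite lerBlDl.
  by rewrite lerBlDl.
apply: bigcup_measurable => g _; apply: measurableX.
  by have [N fN] := finitary_lead c; exact: (fiber_measurable_bits fN).
exact: measurable_clip_ge.
Qed.

Lemma fiber_measurable_reach c a : fiber_measurable (fun w => a <= reach c w).
Proof. by apply: fiber_measurable_bool; exact: measurable_reach_ge. Qed.

(* An entry (c, (a, a')) is a net point of color c with the values of [reach] it needs to capture each of two given points; [cut] says that the first net point to capture one of them does not capture the other. *)
Fixpoint cut (zs : seq (nat * (R * R))) (w : RxR) : bool :=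
  if zs is z :: zs' then
    let h := z.2.1 <= reach z.1 w in let h' := z.2.2 <= reach z.1 w in
    if h && h' then false else if h || h' then true else cut zs' w
  else false.

Lemma fiber_measurable_cut zs : fiber_measurable (cut zs).
Proof.
elim: zs => [|z zs IH] /=; first exact: fiber_measurable_cst.
exact: (fiber_measurable_comp (fun p : bool * bool * bool =>
  if p.1.1 && p.1.2 then false else if p.1.1 || p.1.2 then true else p.2)
  (fiber_measurable_pair (fiber_measurable_pair
    (fiber_measurable_reach z.1 z.2.1) (fiber_measurable_reach z.1 z.2.2)) IH)).
Qed.

Lemma measurable_cut zs : measurable [set w | cut zs w].
Proof. exact: fiber_measurable_cut. Qed.

(** The offsets at which a net point of [g] or [g - 1] steps reaches [a] but not [a']. *)
Definition straddle (g : nat) (a a' : R) : set R :=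
  [set u | [|| (a <= g%:R + clip u < a') | (a <= g%:R - 1 + clip u < a')]].

Lemma straddle_le g (a a' : R) : a <= a' -> a' <= a + 1 ->
  measurable (straddle g a a') /\ (unif (straddle g a a') <= (2 * (a' - a))%:E)%E.
Proof.
move=> aa' aa1.
have mS b b' : measurable [set u | b <= clip u < b'].
  have -> : [set u | b <= clip u < b'] =
      [set u | b <= clip u] `\` [set u | b' <= clip u].
    apply/seteqP; split => u /=; first by case/andP=> -> ?; split => //; rewrite leNgt => /negP.
    by case=> -> /negP; rewrite -ltNge.
  by apply: measurableD; exact: measurable_clip_ge.
have lS (b b' : R) : b <= b' -> (unif [set u | (b <= clip u < b')%R] <= (b' - b)%:E)%E.
  move=> bb; apply: le_trans (unif_itv_le bb).
  rewrite (unifE (mS b b')) (unifE (measurable_itv _)); apply: le_measure; rewrite ?inE;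
    [by apply: measurableI; [exact: mS|exact: measurable_itv]
    |by apply: measurableI; exact: measurable_itv|].
  move=> u /= []; rewrite !in_itv /= => h /andP[u0 u1].
  by move: h; rewrite /clip (min_idPl u1) (max_idPr u0) u0 u1; split.
have e : straddle g a a' = [set u | a - g%:R <= clip u < a' - g%:R] `|`
    [set u | a - (g%:R - 1) <= clip u < a' - (g%:R - 1)].
  apply/seteqP; split => u; rewrite /straddle /= !lerBlDl !ltrBrDl.
    by move/orP.
  by move=> /orP.
rewrite e; split; first by apply: measurableU; exact: mS.
apply: (le_trans (measureU2 unif (mS _ _) (mS _ _))).
rewrite mulr_natl mulr2n EFinD; apply: leeD.
  apply: le_trans (lS _ _ _) _; first by rewrite lerD2r.
  by rewrite lee_fin; lra.
apply: le_trans (lS _ _ _) _; first by rewrite lerD2r.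
by rewrite lee_fin; lra.
Qed.

Lemma measurable_bits_fst (e : (nat -> bool) -> bool) : finitary e -> measurable [set w : RxR | e (bits w.1)].
Proof.
move=> [N fe]; rewrite (_ : [set _ | _] = [set x | e (bits x)] `*` setT).
  by apply: measurableX => //; exact: (fiber_measurable_bits fe true).
by apply/seteqP; split => [[x u]|[x u] []].
Qed.

(** [g] is the ceiling of [a], or 0 for negative [a]. A net point of [g] steps reaches [a] at every
    offset, and one of at most [g - 2] steps at none. *)
Lemma first_capture_threshold (a : R) : exists g : nat,
  a <= g%:R /\ (g = 0%N \/ g%:R - 1 < a).
Proof.
have ex : exists n : nat, a <= n%:R.
  by exists (Num.truncn a).+1; exact: ltW (truncnS_gt _).
exists (ex_minn ex); case: ex_minnP => -[|g] ag mn; split => //; first by left.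
right; rewrite -natr1 addrK ltNge; apply/negP => /mn; by rewrite ltnn.
Qed.

(* Whether a net point straddles the two points depends on the offset only, and weakening the capture events to [g <= lead] and [g.-1 <= lead] makes them depend on the bits only; the sum over the net points then telescopes. *)
Lemma cut_prob (eta : R) zs (e : (nat -> bool) -> bool) :
  0 <= eta -> eta <= 1 -> uniq (map fst zs) ->
  (forall z, z \in zs -> `|z.2.1 - z.2.2| <= eta) ->
  finitary e -> (forall z, z \in zs -> color_free z.1 e) ->
  (coins [set w | e (bits w.1) && cut zs w] <=
   (2 * eta * (2 * bits_prob e + \sum_(z <- zs) (2 ^+ max_lead z.1)^-1))%:E)%E.
Proof.
move=> eta0 eta1; elim: zs e => [|[c [a1 a2]] zs IH] e.
  move=> _ _ fe _ /=; rewrite (_ : [set _ | _] = set0).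
    by rewrite measure0 lee_fin big_nil addr0 !mulr_ge0 // bits_prob_ge0.
  by apply/seteqP; split => // w /=; rewrite andbF.
rewrite /= => /andP[cz uz] close fe ce.
have close1 : `|a1 - a2| <= eta by apply: (close (c, (a1, a2))); rewrite mem_head.
pose a := Num.min a1 a2; pose a' := Num.max a1 a2.
have aa' : a <= a' by rewrite ge_min le_max lexx.
have daa' : a' - a <= eta.
  apply: le_trans close1; rewrite /a /a'.
  by case: (leP a1 a2) => h; [rewrite distrC|]; rewrite ler_norm.
have [g [ag g0]] := first_capture_threshold a.
have [mS lS] : measurable (straddle g a a') /\ (unif (straddle g a a') <= (2 * (a' - a))%:E)%E.
  by apply: straddle_le => //; lra.
pose e1 b := e b && (g.-1 <= lead c b)%N.
pose e2 b := e b && ~~ (g <= lead c b)%N.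
have [N fN] : finitary e1.
  exact: (finitary_map2 (fun p l => p && (g.-1 <= l)%N) fe (finitary_lead c)).
have f2 : finitary e2.
  exact: (finitary_map2 (fun p l => p && ~~ (g <= l)%N) fe (finitary_lead c)).
have m1 : measurable [set x | e1 (bits x)] := fiber_measurable_bits fN true.
pose A := [set x | e1 (bits x)] `*` straddle g a a'.
pose B := [set w | e2 (bits w.1) && cut zs w].
have mA : measurable A by apply: measurableX.
have mB : measurable B.
  rewrite /B (_ : [set _ | _] = [set w | e2 (bits w.1)] `&` [set w | cut zs w]).
    by apply: measurableI; [exact: measurable_bits_fst|exact: measurable_cut].
  by apply/seteqP; split => w /= => [/andP|[-> ->]].
(* Either the first net point captures exactly one of the two points, which requires at least [g.-1]
   steps and a straddling offset, or it captures neither; then it has fewer than [g] steps and the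
   later net points decide. *)
have sub : [set w | e (bits w.1) &&
   (if (a1 <= reach c w) && (a2 <= reach c w) then false
    else if (a1 <= reach c w) || (a2 <= reach c w) then true else cut zs w)]
  `<=` A `|` B.
  move=> [x u] /= /andP[ex].
  have := clip_itv u; set rw := reach c (x, u) => /andP[u0 u1].
  have rwE : rw = (lead c (bits x))%:R + clip u by [].
  have [h|nh] := boolP ((a1 <= rw) || (a2 <= rw)); last first.
    move: (nh); rewrite negb_or => /andP[/negbTE -> /negbTE ->] /= ct.
    right; rewrite /B /e2 /= ex ct andbT /= -ltnNge -(ltr_nat R).
    move: nh; rewrite negb_or -!ltNge => /andP[h1 h2].
    apply: le_lt_trans (_ : rw < _); first by rewrite rwE lerDl.
    by apply: lt_le_trans ag; rewrite lt_min h1.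
  have [//|nh] := ifPn; move=> _; left.
  have ar : a <= rw by rewrite ge_min.
  have ra' : rw < a' by rewrite lt_max; move: nh; rewrite negb_and -!ltNge.
  have gl : (g.-1 <= lead c (bits x))%N.
    case: g0 => [-> //|ga].
    suff : (g < (lead c (bits x)).+2)%N by move: (lead _ _) (g) => l g'; clear; lia.
    rewrite -(ltr_nat R) -!natr1; move: ga ar u1; rewrite rwE; clear.
    by move: (_%:R) (_%:R) (clip u) => *; lra.
  have lg : (lead c (bits x) <= g)%N.
    rewrite -ltnS -(ltr_nat R) -natr1.
    have : (lead c (bits x))%:R <= rw by rewrite rwE lerDl.
    move: ra' daa' ag eta1; clear; move: (_%:R) (_%:R) => *; lra.
  split; first by rewrite /= /e1 ex gl.
  rewrite /straddle /=; apply/orP.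
  have [lE|ne] := eqVneq (lead c (bits x)) g.
    by left; rewrite -lE -rwE ar ra'.
  right; have gS : (lead c (bits x)).+1 = g.
    apply/eqP; rewrite eqn_leq ltn_neqAle ne lg /=.
    by rewrite -[X in (X <= _)%N]prednK ?ltnS // (leq_ltn_trans (leq0n _) (_ : lead c (bits x) < g)%N) // ltn_neqAle ne.
  by rewrite -gS -natr1 addrK -rwE ar ra'.
have mL : measurable [set w | e (bits w.1) && cut ((c, (a1, a2)) :: zs) w].
  rewrite (_ : [set _ | _] = [set w | e (bits w.1)] `&` [set w | cut ((c, (a1, a2)) :: zs) w]).
    by apply: measurableI; [exact: measurable_bits_fst|exact: measurable_cut].
  by apply/seteqP; split => w /= => [/andP|[-> ->]].
apply: le_trans (le_measure coins _ _ sub) _; rewrite ?inE //.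
  exact: measurableU.
apply: (le_trans (measureU2 coins mA mB)).
have pA : (coins A <= (2 * eta * bits_prob e1)%:E)%E.
  have -> : (coins A = (bits_prob e1)%:E * unif (straddle g a a'))%E.
    by rewrite -(bits_probE fN); exact: product_measure1E.
  rewrite mulrC EFinM lee_wpmul2l ?lee_fin ?bits_prob_ge0 //.
  by apply: le_trans lS _; rewrite lee_fin ler_wpM2l.
have pB : (coins B <= (2 * eta * (2 * bits_prob e2 + \sum_(z <- zs) (2 ^+ max_lead z.1)^-1))%:E)%E.
  apply: IH => //.
    by move=> z zzs; apply: close; rewrite inE zzs orbT.
  (* The colors are distinct, so conditioning on [lead c] leaves the bits of the later colors
     free. *)
  move=> z zzs i b; rewrite /e2 (ce z) ?inE ?zzs ?orbT //.
  rewrite color_free_lead //; apply: contraNneq cz => <-.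
  exact: map_f.
apply: le_trans (leeD pA pB) _.
rewrite -EFinD lee_fin -mulrDr ler_wpM2l ?mulr_ge0 //.
rewrite big_cons /=.
have cefree : color_free c e by apply: (ce (c, (a1, a2))); rewrite mem_head.
(* Up to the truncation error, [e1] is at most twice as likely as the part of [e] with
   [g <= lead c]. The rest of [e] is [e2], so both contributions add up to twice the probability of
   [e]. *)
have := bits_prob_lead g fe cefree; rewrite -/e1.
have [M [fM fM']] : exists M, finite_bits M e /\ finite_bits M (fun b => (g <= lead c b)%N).
  have [M1 h1] := fe; have [M2 h2] := finitary_lead c; exists (maxn M1 M2); split.
    by apply: finite_bitsW h1; rewrite leq_maxl.
  have h3 := finite_bitsW (leq_maxr M1 M2) h2.
  by move=> b b' /h3 ->.
have := bits_probD fM fM'; rewrite -/e2.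
by move: (\sum_(z <- zs) _) => S -> h; lra.
Qed.
End Bits.

(** * Nets and clusters in a doubling space *)

Section Packing.
Context {R : realType} (X : metricType R) (ddim : R).
Hypothesis hX : has_doubling_dim X ddim.
Local Open Scope ring_scope.

Lemma iterated_cover t (x : X) (r : R) : 0 < r ->
  exists2 c : seq X, (size c)%:R <= (2 `^ ddim) ^+ t &
    (ball x (2 ^+ t * r) `<=` \bigcup_(y in [set` c]) ball y r)%classic.
Proof.
elim: t x r => [|t IH] x r r0.
  exists [:: x]; first by rewrite expr0.
  by move=> y /=; rewrite expr0 mul1r => xy; exists x => //=; rewrite mem_seq1.
have [|c hc cov] := IH x (2 * r); first by rewrite mulr_gt0.
have h y := hX y r0.
pose f y := proj1_sig (cid2 (h y)).
have f1 y : (size (f y))%:R <= 2 `^ ddim by rewrite /f; case: cid2.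
have f2 y : (ball y (2 * r) `<=` \bigcup_(z in [set` f y]) ball z r)%classic.
  by rewrite /f; case: cid2.
exists (flatten (map f c)).
  rewrite size_flatten /shape -map_comp sumnE big_map natr_sum exprS.
  apply: le_trans (ler_sum _ (fun y _ => f1 y)) _.
  rewrite big_const_seq count_predT iter_addr_0 -[leLHS]mulr_natr.
  by rewrite ler_wpM2l ?powR_ge0.
move=> z; rewrite exprSr -mulrA => /cov[y /= yc] /f2 [u /= uf uz].
by exists u => //=; apply/flattenP; exists (f y) => //; apply: map_f.
Qed.

(** A covering ball of radius [r] contains at most one point of [l]. *)
Lemma packing t (x : X) (r : R) (l : seq X) : 0 < r ->
  (forall y, y \in l -> mdist x y < 2 ^+ t * r) ->
  pairwise (fun y z => 2 * r <= mdist y z) l ->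
  (size l)%:R <= (2 `^ ddim) ^+ t.
Proof.
move=> r0 near sep; have [c hc cov] := iterated_cover t x r0.
apply: le_trans hc; rewrite ler_nat.
have ex y : exists z, y \in l -> z \in c /\ mdist z y < r.
  have [yl|] := boolP (y \in l); last by exists y.
  have : ball x (2 ^+ t * r) y by rewrite ballEmdist /=; exact: near.
  by move=> /cov[z /= zc]; rewrite ballEmdist /= => zy; exists z.
have [f fP] := choice ex.
rewrite -(size_map f); apply: uniq_leq_size.
  rewrite uniq_pairwise pairwise_map.
  apply: (@sub_in_pairwise _ (mem l) (fun y z => 2 * r <= mdist y z)) sep; last first.
    by apply/allP.
  move=> y z yl zl /= yz; apply/negP => /eqP e.
  have [_ h1] := fP y yl; have [_ h2] := fP z zl.
  move: yz; rewrite leNgt; apply/negP/negPn.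
  apply: le_lt_trans (metric_triangle y (f y) z) _.
  by rewrite metric_sym e mulr2n mulrDl mul1r ltrD // -e.
by move=> z /mapP[y /fP[yc _] ->].
Qed.

(** With [ddim < 1] every cover is a single ball, so a ball around two points can be halved. Two
    halvings reach a radius of half their distance, which contradicts the triangle inequality. *)
Lemma doubling_dim_ge1 (x y : X) : x != y -> 1 <= ddim.
Proof.
rewrite -mdist_gt0 => d0; rewrite leNgt; apply/negP => lt1.
have shrink z r : 0 < r -> mdist z x < 2 * r -> mdist z y < 2 * r ->
    exists2 z', mdist z' x < r & mdist z' y < r.
  move=> r0; have [c hc cov] := hX z r0; move=> zx zy.
  have c1 : (size c < 2)%N.
    rewrite -(ltr_nat R); apply: le_lt_trans hc _.
    rewrite -ltr_ln ?posrE ?powR_gt0 // ln_powR gtr_pMl // ln_gt0 //.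
    by rewrite ltr1n.
  have inb u : mdist z u < 2 * r -> exists2 v, v \in c & mdist v u < r.
    move=> zu; have /cov[v /= vc] : ball z (2 * r) u by rewrite ballEmdist.
    by rewrite ballEmdist; exists v.
  have [v vc vx] := inb x zx; have [v' vc' vy] := inb y zy.
  have e : v' = v; last by exists v => //; rewrite -e.
  by case: (c) c1 vc vc' => [|v0 [|]] //= _; rewrite !inE => /eqP -> /eqP ->.
have [||z zx zy] := shrink x (mdist x y) d0; first by rewrite mdistxx mulr_gt0.
  by rewrite mulr_natl mulr2n ltrDl.
have d2 : 2 * (mdist x y / 2) = mdist x y by rewrite mulrCA divff ?mulr1.
have [|||u ux uy] := shrink z (mdist x y / 2); rewrite ?d2 // ?divr_gt0 //.
have := metric_triangle x u y; rewrite (metric_sym x u).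
by rewrite leNgt => /negP; apply; rewrite [ltRHS]splitr ltrD.
Qed.
End Packing.

Definition mex (l : seq nat) : nat := find (fun c => c \notin l) (iota 0 (size l).+1).

Lemma mexP l : mex l \notin l /\ (mex l <= size l)%N.
Proof.
have : has (fun c => c \notin l) (iota 0 (size l).+1).
  apply/negPn/negP => /hasPn h.
  suff : (size (iota 0 (size l).+1) <= size l)%N by rewrite size_iota ltnn.
  by apply: uniq_leq_size (iota_uniq _ _) _ => x /h; rewrite negbK.
move=> h; have := nth_find 0%N h; have := h; rewrite has_find size_iota => lt.
by rewrite nth_iota // add0n.
Qed.

Fixpoint first_capture (cap : nat * nat -> bool) (s : seq (nat * nat)) : nat :=
  if s is p :: s' then if cap p then p.1 else first_capture cap s' else 0%N.

Lemma first_capture_cat cap s t : has cap s ->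
  first_capture cap (s ++ t) = first_capture cap s.
Proof. by elim: s => //= p s IH; case: ifP. Qed.

Lemma first_captureP cap s : has cap s ->
  exists2 p, p \in s & cap p /\ first_capture cap s = p.1.
Proof.
elim: s => //= p s IH; case: ifP => [cp _|_ /IH[q qs h]].
  by exists p; rewrite ?mem_head.
by exists q; rewrite // inE qs orbT.
Qed.

(** * Greedy nets, colors and random cells *)

Section Cells.
Context {R : realType}.
Notation RxR := (measurableTypeR R * measurableTypeR R)%type.
Local Open Scope ring_scope.
Implicit Types (dd : nat -> nat -> R) (k : int) (w : R * R).

Definition scale k : R := 2 ^ k.

Lemma scale_gt0 k : 0 < scale k.
Proof. by rewrite /scale exprz_gt0. Qed.

Lemma scaleS k : scale (k + 1) = 2 * scale k.
Proof. by rewrite /scale exprzDr ?unitfE // expr1z mulrC. Qed.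

Lemma le_scale k l : k <= l -> scale k <= scale l.
Proof. by move=> kl; rewrite /scale ler_weXz2l // ler1n. Qed.

(* Entries are pairs (point, color). Only the minimal radius decides who joins the net, so that net and colors do not depend on the coins; any two net points that can capture one of two points at distance at most [scale k] are within [4 * scale k]. *)
Fixpoint net dd k (n : nat) : seq (nat * nat) :=
  if n is x.+1 then
    let s := net dd k x in
    if all (fun p => scale k / 2 < dd p.1 x) s
    then rcons s (x, mex [seq p.2 | p <- s & dd p.1 x <= 4 * scale k])
    else s
  else [::].

Definition radius k (c : nat) w : R :=
  scale k * (1 / 2 + reach c w / (2 * (max_lead c).+1%:R)).

Definition captures dd k w x (p : nat * nat) : bool := dd p.1 x <= radius k p.2 w.

(** A cell is named by its net point. Only the net of the points up to [x] is searched, so the cell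
    of [x] is settled when [x] arrives. *)
Definition cell dd k w x : nat := first_capture (captures dd k w x) (net dd k x.+1).

Lemma reach_itv c w : 0 <= reach c w <= (max_lead c).+1%:R.
Proof.
have := clip_itv w.2; have : (lead c (bits w.1))%:R <= (max_lead c)%:R :> R.
  by rewrite ler_nat lead_max.
rewrite /reach -natr1; have := ler0n R (lead c (bits w.1)); lra.
Qed.

Lemma radius_itv k c w : scale k / 2 <= radius k c w <= scale k.
Proof.
rewrite /radius; have /andP[r0 rK] := reach_itv c w.
have K0 : 0 < (max_lead c).+1%:R :> R by rewrite ltr0n.
set q := _ / (2 * _).
have q0 : 0 <= q by rewrite divr_ge0 // mulr_ge0 // ltW.
have q1 : q <= 1 / 2.
  by rewrite /q ler_pdivrMr ?mulr_gt0 // mulrA mul1r mulVf // mul1r.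
have := scale_gt0 k; nra.
Qed.

(** Capture becomes a threshold on [reach], the form that [cut] works with. *)
Lemma captures_reach dd k w x p : captures dd k w x p =
  ((dd p.1 x / scale k - 1 / 2) * (2 * (max_lead p.2).+1%:R) <= reach p.2 w).
Proof.
have K0 : 0 < 2 * (max_lead p.2).+1%:R :> R by rewrite mulr_gt0 ?ltr0n.
rewrite /captures /radius -(ler_pdivlMr _ _ K0) lerBlDl.
by rewrite ler_pdivrMr ?scale_gt0 // [X in _ <= X]mulrC.
Qed.

Lemma net_lt dd k n p : p \in net dd k n -> (p.1 < n)%N.
Proof.
elim: n => //= n IH; case: ifP => _; last by move/IH/ltnW.
by rewrite mem_rcons inE => /orP[/eqP->//|/IH/ltnW].
Qed.

Lemma eq_net dd dd' k n : (forall x y, (x < n)%N -> (y < n)%N -> dd x y = dd' x y) ->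
  net dd k n = net dd' k n.
Proof.
elim: n => //= n IH e.
have {}IH : net dd k n = net dd' k n.
  by apply: IH => x y xn yn; rewrite e // ltnW.
rewrite IH (@eq_in_all _ _ (fun p => scale k / 2 < dd' p.1 n)); last first.
  by move=> p /net_lt pn; rewrite e // ltnW.
rewrite (@eq_in_filter _ _ (fun p => dd' p.1 n <= 4 * scale k)) //.
by move=> p /net_lt pn; rewrite e // ltnW.
Qed.

Lemma eq_first_capture cap cap' s : {in s, cap =1 cap'} ->
  first_capture cap s = first_capture cap' s.
Proof.
elim: s => //= p s IH e; rewrite e ?mem_head // IH // => q qs.
by rewrite e // inE qs orbT.
Qed.

Lemma eq_cell dd dd' k w x : (forall y z, (y <= x)%N -> (z <= x)%N -> dd y z = dd' y z) ->
  cell dd k w x = cell dd' k w x.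
Proof.
move=> e; rewrite /cell (@eq_net dd dd') //.
by apply: eq_first_capture => p /net_lt px; rewrite /captures e.
Qed.

Lemma net_prefix dd k n m : (n <= m)%N ->
  exists t, net dd k m = net dd k n ++ t.
Proof.
move=> /subnK <-; elim: (m - n)%N => [|j [t IH]]; first by exists [::]; rewrite cats0.
rewrite addSn /=; case: ifP => _; last by exists t.
by rewrite IH rcons_cat; eexists.
Qed.

Lemma net_separated dd k n :
  pairwise (fun p q => scale k / 2 < dd p.1 q.1) (net dd k n).
Proof.
by elim: n => //= n IH; case: ifP => // h; rewrite pairwise_rcons IH andbT.
Qed.

Lemma net_colors dd k n :
  pairwise (fun p q => (dd p.1 q.1 <= 4 * scale k) ==> (p.2 != q.2)) (net dd k n).
Proof.
elim: n => //= n IH; case: ifP => // h; rewrite pairwise_rcons IH andbT.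
apply/allP => p pin /=; apply/implyP => pn.
apply: contraNneq (mexP [seq p.2 | p <- net dd k n & dd p.1 n <= 4 * scale k]).1 => <-.
by apply: map_f; rewrite mem_filter pn.
Qed.

(** The color is at most the number of earlier net points nearby; these are separated, so that
    [packing] can bound them. *)
Lemma net_color_size dd k n p : p \in net dd k n -> exists l : seq nat,
  [/\ pairwise (fun x y => scale k / 2 < dd x y) l,
      {in l, forall x, dd x p.1 <= 4 * scale k} & (p.2 <= size l)%N].
Proof.
elim: n => //= n IH; case: ifP => // h; rewrite mem_rcons inE => /orP[/eqP->|/IH //].
exists [seq q.1 | q <- net dd k n & dd q.1 n <= 4 * scale k]; split.
- by rewrite pairwise_map; apply: pairwise_filter; exact: net_separated.
- by move=> x /mapP[q]; rewrite mem_filter => /andP[qn _] ->.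
- by rewrite /= size_map; have [_] := mexP [seq p.2 | p <- net dd k n & dd p.1 n <= 4 * scale k]; rewrite size_map.
Qed.

Lemma fiber_measurable_if d (T : measurableType d) (U : Type) (b : T -> bool) (f g : T -> U) :
  fiber_measurable b -> fiber_measurable f -> fiber_measurable g ->
  fiber_measurable (fun t => if b t then f t else g t).
Proof.
move=> mb mf mg u.
have -> : [set t | (if b t then f t else g t) = u]%classic =
    (([set t | b t = true] `&` [set t | f t = u]) `|`
     ([set t | b t = false] `&` [set t | g t = u]))%classic.
  apply/seteqP; split => t /=; first by case: (b t); [left|right].
  by case=> -[-> ->].
by apply: measurableU; apply: measurableI.
Qed.

Lemma measurable_eq_fiber d (T : measurableType d) (f g : T -> nat) :
  fiber_measurable f -> fiber_measurable g -> measurable [set t | f t = g t]%classic.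
Proof.
move=> mf mg.
have -> : [set t | f t = g t]%classic =
    (\bigcup_n ([set t | f t = n] `&` [set t | g t = n]))%classic.
  by apply/seteqP; split => [t /= e|t [n _ [/= -> ->]]] //; exists (f t).
by apply: bigcupT_measurable => n; apply: measurableI.
Qed.

Lemma fiber_measurable_cell dd k x :
  fiber_measurable (fun w : RxR => cell dd k w x).
Proof.
rewrite /cell; elim: (net dd k x.+1) => [|p s IH] /=.
  exact: fiber_measurable_cst.
apply: fiber_measurable_if => //; last exact: fiber_measurable_cst.
have -> : (fun w : RxR => captures dd k w x p) =
    (fun w => (dd p.1 x / scale k - 1 / 2) * (2 * (max_lead p.2).+1%:R) <= reach p.2 w).
  by apply/funext => w; rewrite captures_reach.
exact: fiber_measurable_reach.
Qed.

Section Metric.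
Variables (X : metricType R) (s : nat -> X).
Let dd x y := mdist (s x) (s y).

(** A net point captures itself, and a point refused by the net is within the minimal radius of an
    earlier net point. *)
Lemma net_captures k w x : has (captures dd k w x) (net dd k x.+1).
Proof.
rewrite /=; have [h|] := boolP (all _ _).
  rewrite has_rcons; apply/orP; left; rewrite /captures /= /dd mdistxx.
  have /andP[+ _] := radius_itv k (mex [seq p.2 | p <- net dd k x & dd p.1 x <= 4 * scale k]) w.
  by apply: le_trans; rewrite divr_ge0 // ltW // scale_gt0.
move=> /allPn[p pin]; rewrite -leNgt => px; apply/hasP; exists p => //.
by apply: le_trans px _; case/andP: (radius_itv k p.2 w).
Qed.

Lemma cellE k w x n : (x < n)%N ->
  cell dd k w x = first_capture (captures dd k w x) (net dd k n).
Proof.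
by move=> /(net_prefix dd k)[t ->]; rewrite first_capture_cat // net_captures.
Qed.

Lemma cell_near k w x : dd (cell dd k w x) x <= scale k.
Proof.
have [p _ [cp e]] := first_captureP (net_captures k w x).
by rewrite /cell e; apply: le_trans cp _; case/andP: (radius_itv k p.2 w).
Qed.

Lemma cell_diam k w x y : cell dd k w x = cell dd k w y -> dd x y <= 2 * scale k.
Proof.
move=> e; have := cell_near k w x; have := cell_near k w y; rewrite -e.
set c := cell _ _ _ _; have := metric_triangle (s x) (s c) (s y).
rewrite /dd (metric_sym (s x) (s c)); lra.
Qed.

Lemma cell_eq0 k w x y : dd x y = 0 -> cell dd k w x = cell dd k w y.
Proof.
rewrite /dd => /mdist_positivity e.
rewrite (@cellE _ _ x (maxn x y).+1) ?ltnS ?leq_maxl //.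
rewrite (@cellE _ _ y (maxn x y).+1) ?ltnS ?leq_maxr //.
by apply: eq_first_capture => p _; rewrite /captures /dd e.
Qed.

(** The first point heads every net and captures all points within the minimal radius. *)
Lemma cell_top k w x : dd 0%N x <= scale k / 2 -> cell dd k w x = 0%N.
Proof.
move=> h; rewrite /cell; have [t ->] := @net_prefix dd k 1 x.+1 isT.
rewrite /= ifT // /captures /=; apply: le_trans h _.
by case/andP: (radius_itv k (mex [::]) w).
Qed.

(** Net points beyond the maximal radius of both points capture neither and can be skipped. Those
    left are close to each other, which will make their colors distinct. *)
Lemma first_capture_cut k w u v (r : seq (nat * nat)) :
  first_capture (captures dd k w u) r <> first_capture (captures dd k w v) r ->
  cut [seq (p.2, ((dd p.1 u / scale k - 1 / 2) * (2 * (max_lead p.2).+1%:R),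
                  (dd p.1 v / scale k - 1 / 2) * (2 * (max_lead p.2).+1%:R)))
      | p <- r & (dd p.1 u <= scale k) || (dd p.1 v <= scale k)] w.
Proof.
elim: r => //= p r IH; have [near|far] := boolP (_ || _); rewrite /= -?captures_reach.
  by case: (captures dd k w u p); case: (captures dd k w v p).
have nocap x : (dd p.1 x <= scale k) = false -> captures dd k w x p = false.
  move=> /negbT; rewrite -ltNge /captures => h; apply/negbTE; rewrite -ltNge.
  by apply: le_lt_trans h; case/andP: (radius_itv k p.2 w).
by move: far; rewrite negb_or => /andP[/negbTE fu /negbTE fv]; rewrite !nocap.
Qed.

Lemma sum_max_lead (l : seq nat) : uniq l ->
  \sum_(c <- l) ((2 ^+ max_lead c)^-1 : R) <= 2.
Proof.
move=> ul; pose f c : R := (2 ^+ max_lead c)^-1; pose M := (\max_(c <- l) c)%N.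
have f0 c : 0 <= f c by rewrite invr_ge0 exprn_ge0.
have fle c : f c <= (c.+1%:R ^+ 2)^-1.
  rewrite lef_pV2 ?posrE ?exprn_gt0 // ?ltr0n // /max_lead -muln2 exprM.
  by rewrite ler_pXn2r ?nnegrE ?exprn_ge0 // -natrX ler_nat ltnW // trunc_log_ltn.
have lM : perm_eq l [seq c <- iota 0 M.+1 | c \in l].
  apply: uniq_perm => //; first by rewrite filter_uniq // iota_uniq.
  move=> c; rewrite mem_filter mem_iota add0n /= ltnS.
  by have [cl|//] := boolP (c \in l); rewrite /M (leq_bigmax_seq (F := id)).
rewrite (perm_big _ lM) big_filter -/(f _).
have : \sum_(c <- iota 0 M.+1 | c \in l) f c <= \sum_(c <- iota 0 M.+1) f c.
  by rewrite big_mkcond; apply: ler_sum => c _; case: ifP.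
move=> /le_trans; apply.
(* The sharper bound telescopes: [1 / (m + 2)^2] is at most [1 / (m + 1) - 1 / (m + 2)]. *)
suff : \sum_(c <- iota 0 M.+1) f c <= 2 - M.+1%:R^-1.
  by move=> /le_trans; apply; rewrite gerBl invr_ge0.
elim: (M) => [|m IH].
  rewrite big_seq1; apply: le_trans (fle 0%N) _; rewrite expr1n invr1; lra.
rewrite -[in iota _ _]addn1 iotaD big_cat big_seq1 /= add0n.
apply: le_trans (lerD IH (fle _)) _.
have m0 : 0 < m.+1%:R :> R by rewrite ltr0n.
have m1 : 0 < m.+2%:R :> R by rewrite ltr0n.
have mm : m.+2%:R = m.+1%:R + 1 :> R by rewrite -natr1.
have : (m.+2%:R ^+ 2)^-1 <= (m.+1%:R)^-1 - (m.+2%:R)^-1 :> R.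
  have -> : (m.+1%:R)^-1 - (m.+2%:R)^-1 = (m.+1%:R * m.+2%:R)^-1 :> R.
    move: m0 m1; rewrite mm; move: (m.+1%:R : R) => a a0 a1.
    by field; rewrite !gt_eqF.
  by rewrite lef_pV2 ?posrE ?mulr_gt0 ?exprn_gt0 // expr2 ler_pM2r // ler_nat.
by move: (_^-1) (_^-1) (_^-1) => a b c; clear; lra.
Qed.

Lemma max_lead_color (ddim : R) k n p : has_doubling_dim X ddim -> 1 <= ddim ->
  p \in net dd k n -> (max_lead p.2).+1%:R <= 15 * ddim.
Proof.
move=> hX dim1 /net_color_size[l [sep near cl]].
(* For [r = scale k / 4] the points are [2 * r] apart and within [4 * scale k = 2 ^ 4 * r], hence
   strictly within [2 ^ 5 * r]. *)
have szl : (size l)%:R <= (2 `^ ddim) ^+ 5.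
  rewrite -(size_map s); apply: (packing hX (x := s p.1) (r := scale k / 4)).
  - by rewrite divr_gt0 ?scale_gt0.
  - move=> _ /mapP[x xl ->]; rewrite metric_sym; apply: le_lt_trans (near x xl) _.
    have := scale_gt0 k; rewrite !exprS expr0; lra.
  - rewrite pairwise_map; apply: sub_pairwise sep => x y /=; rewrite /dd => h.
    by apply: le_trans (ltW h); lra.
pose t := trunc_log 2 p.2.+1.
have tle : t%:R <= 5 * ddim + 1.
  rewrite -(@ler_pM2r _ (ln 2)) ?ln_gt0 ?ltr1n // -ln_powR -ln_powR.
  rewrite ler_ln ?posrE ?powR_gt0 //.
  rewrite powR_mulrn // -natrX.
  apply: le_trans (_ : p.2.+1%:R <= _); first by rewrite ler_nat trunc_logP.
  rewrite powRD ?pnatr_eq0 ?implybT // powRr1 // [5 * _]mulrC powRrM powR_mulrn ?powR_ge0 //.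
  rewrite -natr1; have : p.2%:R <= (2 `^ ddim) ^+ 5 :> R.
    by apply: le_trans szl; rewrite ler_nat.
  have : 1 <= (2 `^ ddim) ^+ 5 :> R.
    by rewrite exprn_ege1 // -[leLHS](powRr0 2) ler_powR ?ler1n //; lra.
  lra.
(* The left-hand side is [2 * t + 3 <= 10 * ddim + 5], and [1 <= ddim]. *)
by rewrite /max_lead -/t -natr1 -muln2 natrM -natr1; lra.
Qed.

(** [eta] bounds the difference between the thresholds of [u] and [v], as [2 * (max_lead c).+1] is
    at most [30 * ddim] by [max_lead_color]. Then [cut_prob] gives [2 * eta * (2 + 2)]. *)
Lemma cell_cut_prob (ddim : R) k u v : has_doubling_dim X ddim -> 1 <= ddim ->
  (coins [set w | cell dd k w u != cell dd k w v]%classic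
    <= (240 * ddim * dd u v / scale k)%:E)%E.
Proof.
move=> hX dim1; pose n := (maxn u v).+1.
pose eta := 2 * (15 * ddim) * dd u v / scale k.
have sc := scale_gt0 k.
have d0 : 0 <= dd u v by exact: mdist_ge0.
have eta0 : 0 <= eta.
  by apply: divr_ge0; [rewrite mulr_ge0 //; lra|exact: ltW].
have -> : 240 * ddim * dd u v / scale k = 8 * eta.
  by rewrite /eta; field; rewrite gt_eqF.
have mC : measurable [set w : RxR | cell dd k w u != cell dd k w v]%classic.
  rewrite (_ : [set w | _] = ~` [set w | cell dd k w u = cell dd k w v])%classic.
    by apply: measurableC; apply: measurable_eq_fiber; exact: fiber_measurable_cell.
  by apply/seteqP; split => w /= /eqP.
(* For [eta > 1] the claimed bound exceeds 1. *)
have [eta1|eta1] := leP eta 1; last first.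
  by apply: le_trans (probability_le1 _ mC) _; rewrite lee_fin; lra.
pose thr (p : nat * nat) x := (dd p.1 x / scale k - 1 / 2) * (2 * (max_lead p.2).+1%:R).
pose near (p : nat * nat) := (dd p.1 u <= scale k) || (dd p.1 v <= scale k).
pose zs := [seq (p.2, (thr p u, thr p v)) | p <- net dd k n & near p].
have sub : ([set w : RxR | cell dd k w u != cell dd k w v] `<=`
            [set w | true && cut zs w])%classic.
  move=> w /= /eqP; rewrite (@cellE k w u n) ?ltnS ?leq_maxl //.
  rewrite (@cellE k w v n) ?ltnS ?leq_maxr //; exact: first_capture_cut.
have uvs : dd u v <= scale k.
  move: eta1; rewrite /eta ler_pdivrMr // mul1r; apply: le_trans.
  by rewrite ler_peMl //; lra.
have tri x y z : dd x z <= dd x y + dd y z by exact: metric_triangle.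
have sy x y : dd x y = dd y x by exact: metric_sym.
(* Net points within [scale k] of [u] or [v] are within [3 * scale k] of each other, hence differ in
   color. *)
have uzs : uniq [seq z.1 | z <- zs].
  rewrite -map_comp uniq_pairwise pairwise_map.
  have := pairwise_filter near (net_colors dd k n).
  apply: (@sub_in_pairwise _ near); last exact: filter_all.
  move=> p q np nq /implyP; apply.
  have h1 := tri p.1 u q.1; have h2 := tri p.1 v q.1.
  have h3 := tri u v q.1; have h4 := tri v u q.1.
  have e1 := sy u q.1; have e2 := sy v q.1; have e3 := sy u v.
  by case/orP: np => np; case/orP: nq => nq; move: sc uvs; clear -h1 h2 h3 h4 e1 e2 e3 np nq; lra.
have close z : z \in zs -> `|z.2.1 - z.2.2| <= eta.
  move=> /mapP[p]; rewrite mem_filter => /andP[_ pin] -> /=.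
  have := max_lead_color hX dim1 pin; pose K : R := (max_lead p.2).+1%:R; rewrite -/K => KL.
  have K0 : 0 <= K by exact: ler0n.
  have -> : thr p u - thr p v = (dd p.1 u - dd p.1 v) * (2 * K / scale k).
    by rewrite /thr /=; ring.
  have Ks : 0 <= 2 * K / scale k by rewrite divr_ge0 ?mulr_ge0 // ltW.
  rewrite normrM (ger0_norm Ks) /eta.
  apply: le_trans (_ : dd u v * (2 * K / scale k) <= _).
    rewrite ler_wpM2r //.
    have := tri p.1 u v; have := tri p.1 v u; rewrite (sy v u) ler_norml; lra.
  rewrite [leLHS](_ : _ = 2 * K * dd u v / scale k); last by ring.
  rewrite ler_wpM2r ?invr_ge0 ?(ltW sc) //.
  by rewrite ler_wpM2r // ler_pM2l.
have ft : finitary (fun _ : nat -> bool => true) by exists 0%N.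
have := @cut_prob R eta zs (fun=> true) eta0 eta1 uzs close ft (fun _ _ _ _ => erefl).
have : (coins [set w | cell dd k w u != cell dd k w v]%classic <=
        coins [set w | true && cut zs w]%classic)%E.
  by apply: le_measure; rewrite ?inE //; exact: measurable_cut.
move=> /le_trans h /h{h} /le_trans; apply; rewrite lee_fin.
have p1 : bits_prob (fun=> true) <= 1 :> R by have [N fN] := ft; apply: bits_prob_le1 fN.
have S2 : \sum_(z <- zs) ((2 ^+ max_lead z.1)^-1 : R) <= 2.
  by have := sum_max_lead uzs; rewrite big_map.
rewrite [leRHS](_ : _ = 2 * eta * 4); last by ring.
apply: ler_wpM2l; first exact: mulr_ge0.
rewrite [leRHS](_ : _ = 2 * 1 + 2); last by ring.
by rewrite lerD // ler_pM2l.
Qed.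
End Metric.
End Cells.

(** * The algorithm *)

Section SetMatchings.
Local Open Scope set_scope.

Definition mate m (M : {set {set 'I_m}}) (x : nat) : nat :=
  if insub x is Some i then
    if [pick y : 'I_m | (y != i) && ([set i; y] \in M)] is Some y then y : nat else x
  else x.

Definition matching_of m (mu : nat -> nat) : {set {set 'I_m}} :=
  [set [set i; insubd i (mu i)] | i : 'I_m].

Lemma mate_lt m (M : {set {set 'I_m}}) x : x < m -> mate M x < m.
Proof. by move=> xm; rewrite /mate insubT; case: pickP. Qed.

Lemma eq_set2 (T : finType) (x y z : T) : [set x; y] = [set x; z] -> y = z.
Proof.
move=> e; have [yx|yx] := eqVneq y x.
  have : z \in [set x; y] by rewrite e !inE eqxx orbT.
  by rewrite !inE yx orbb => /eqP ->.
have : y \in [set x; z] by rewrite -e !inE eqxx orbT.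
by rewrite !inE (negbTE yx) => /eqP.
Qed.

Section Perfect.
Variables (m : nat) (M : {set {set 'I_m}}).
Hypothesis pM : perfect_matching M.

Lemma perfect_block (e : {set 'I_m}) (i : 'I_m) : e \in M -> i \in e ->
  exists2 j, j != i & e = [set i; j].
Proof.
case/andP: pM => _ /forall_inP c2 eM ie.
have /cards2P[a [b [ab e2]]] := c2 _ eM; move: ie; rewrite e2 !inE.
case/orP => /eqP ->; [exists b; rewrite // eq_sym //|exists a => //].
by rewrite finset.setUC.
Qed.

Lemma perfect_mate (i : 'I_m) : exists2 j : 'I_m, j != i & [set i; j] \in M.
Proof.
case/andP: (pM) => /and3P[/eqP cov _ _] _.
have : i \in finset.cover M by rewrite cov finset.in_setT.
by case/finset.bigcupP => e eM ie; have [j ne ej] := perfect_block eM ie; exists j; rewrite -?ej.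
Qed.

Lemma perfect_mate_uniq (i j k : 'I_m) :
  [set i; j] \in M -> [set i; k] \in M -> j = k.
Proof.
case/andP: (pM) => /and3P[_ /finset.trivIsetP tri _] _ h1 h2.
have [e|ne] := eqVneq [set i; j] [set i; k]; first exact: eq_set2 e.
have := tri _ _ h1 h2 ne; rewrite -finset.setI_eq0 => /eqP/finset.setP/(_ i).
by rewrite !inE eqxx.
Qed.

Lemma mateP (i : 'I_m) : exists j : 'I_m,
  [/\ mate M i = j, j != i & [set i; j] \in M].
Proof.
rewrite /mate valK; case: pickP => [j /andP[ji jM]|no]; first by exists j.
by have [j ne jM] := perfect_mate i; move: (no j); rewrite ne jM.
Qed.

Lemma mateE (i j : 'I_m) : i != j -> ([set i; j] \in M) = (mate M i == j).
Proof.
move=> ij; have [k [-> ki kM]] := mateP i.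
apply/idP/eqP => [jM|/val_inj <- //]; by rewrite (perfect_mate_uniq jM kM).
Qed.

Lemma mate_matching : fun_matching m (mate M).
Proof.
move=> x xm; have [j [e ji jM]] := mateP (Ordinal xm); rewrite /= in e.
rewrite e ltn_ord; split => //.
have [k [e' kj kM]] := mateP j; rewrite e'.
by rewrite finset.setUC in jM; rewrite (perfect_mate_uniq kM jM).
Qed.
End Perfect.

Section OfFunction.
Variables (m : nat) (mu : nat -> nat).
Hypothesis mm : fun_matching m mu.

Lemma val_partner (i : 'I_m) : insubd i (mu i) = mu i :> nat.
Proof. by rewrite val_insubd; case: (mm (ltn_ord i)) => ->. Qed.

Lemma mem_matching_of (i j : 'I_m) : i != j ->
  ([set i; j] \in matching_of m mu) = (mu i == j).
Proof.
move=> ij; apply/imsetP/eqP => [[k _ e]|e]; last first.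
  by exists i => //; congr [set _; _]; apply: ord_inj; rewrite val_partner.
have : i \in [set k; insubd k (mu k)] by rewrite -e !inE eqxx.
rewrite !inE => /orP[/eqP ik|/eqP ik].
  by move: e; rewrite ik => /eq_set2 ->; rewrite val_partner.
have -> : j = k; last by rewrite ik val_partner; case: (mm (ltn_ord k)).
by move: e; rewrite -ik finset.setUC [RHS]finset.setUC finset.setUC [RHS]finset.setUC => e; apply: (@eq_set2 _ i); rewrite e finset.setUC.
Qed.

Lemma matching_of_perfect : perfect_matching (matching_of m mu).
Proof.
have ne (i : 'I_m) : i != insubd i (mu i).
  by rewrite -(inj_eq (@ord_inj m)) val_partner eq_sym; case: (mm (ltn_ord i)).
apply/andP; split; last first.
  by apply/forall_inP => e /imsetP[i _ ->]; rewrite cards2 ne.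
apply/and3P; split.
- apply/eqP/finset.setP => i; rewrite inE; apply/finset.bigcupP.
  exists [set i; insubd i (mu i)]; first exact: imset_f.
  by rewrite !inE eqxx.
- apply/finset.trivIsetP => A B /imsetP[i _ ->] /imsetP[j _ ->] AB.
  rewrite -finset.setI_eq0; apply/eqP/finset.setP => x; rewrite finset.in_set0; apply/negbTE.
  apply: contra AB; rewrite finset.in_setI => /andP[xi xj]; apply/eqP.
  have block (k : 'I_m) : x \in [set k; insubd k (mu k)] ->
      [set k; insubd k (mu k)] = [set x; insubd x (mu x)].
    rewrite !inE => /orP[/eqP -> //|/eqP xk].
    rewrite finset.setUC -xk; congr [set _; _]; apply: ord_inj; rewrite val_partner xk.
    by rewrite val_partner; case: (mm (ltn_ord k)) => _ ->.
  by rewrite (block i xi) (block j xj).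
- apply/negP => /imsetP[i _ /finset.setP/(_ i)]; by rewrite !inE eqxx.
Qed.

Lemma mate_matching_of x : x < m -> mate (matching_of m mu) x = mu x.
Proof.
move=> xm; have [j [e ji jM]] := mateP matching_of_perfect (Ordinal xm).
rewrite /= in e; rewrite e; move: jM; rewrite mem_matching_of 1?eq_sym //.
by move/eqP => /= ->.
Qed.
End OfFunction.

(** Every deleted edge is the old edge of a point whose partner has changed. *)
Lemma deleted_edges_le i (M : {set {set 'I_(i.*2)}}) mu : perfect_matching M ->
  fun_matching (i.+1.*2) mu ->
  #|deleted_edges M (matching_of i.+1.*2 mu)| <= \sum_(x < i.*2) (mu x != mate M x).
Proof.
move=> pM mm.
pose B := [set x : 'I_(i.*2) | mu x != mate M x].
have -> : \sum_(x < i.*2) (mu x != mate M x) = #|B|.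
  by rewrite -sum1_card [RHS]big_mkcond; apply: eq_bigr => x _; rewrite inE; case: (_ != _).
apply: leq_trans (leq_imset_card (fun x : 'I_(i.*2) => [set x; insubd x (mate M x)]) (mem B)).
apply: subset_leq_card; apply/fintype.subsetP => e; rewrite inE => /andP[eM eM'].
have [x xe] : exists x, x \in e.
  case/andP: (pM) => _ /forall_inP/(_ _ eM) /cards2P[a [b [_ ->]]].
  by exists a; rewrite !inE eqxx.
have [y yx ey] := perfect_block pM eM xe.
have xy : x != y by rewrite eq_sym.
have My : mate M x = y by apply/eqP; rewrite -mateE // -ey.
apply/imsetP; exists x; last first.
  by rewrite ey; congr [set _; _]; apply: ord_inj; rewrite val_insubd My ltn_ord.
rewrite inE My; apply: contraNneq eM' => mxy.
rewrite ey imsetU1 imset_set1 mem_matching_of //; first by rewrite /= mxy.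
Qed.
End SetMatchings.

Section Cost.
Local Open Scope ring_scope.
Context {R : realType}.

Definition mxdist m (D : 'M[R]_m) (x y : nat) : R :=
  if insub x is Some i then if insub y is Some j then D i j else 0 else 0.

Lemma mxdistE m (D : 'M[R]_m) (i j : 'I_m) : mxdist D i j = D i j.
Proof. by rewrite /mxdist !valK. Qed.

Lemma cost_mate m (D : 'M[R]_m) (M : {set {set 'I_m}}) : perfect_matching M ->
  (forall i j, D i j = D j i) ->
  2 * cost D M = \sum_(x < m) mxdist D x (mate M x).
Proof.
move=> pM sD; have mm := mate_matching pM.
have -> : cost D M = \sum_(x < m) if (x < mate M x)%N then mxdist D x (mate M x) else 0.
  apply: eq_bigr => j _; have [k [e kj kM]] := mateP pM j.
  rewrite e mxdistE; case: ifP => jk.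
    rewrite (big_pred1 k) // => l /=.
    apply/andP/eqP => [[_ lM]|->]; last by [].
    exact: perfect_mate_uniq lM kM.
  rewrite big1 // => l /andP[jl lM].
  by move: jk; rewrite (perfect_mate_uniq pM kM lM) jl.
rewrite mulr_natl mulr2n.
rewrite -{1}(reindex_matching _ (fun x => if (x < mate M x)%N then mxdist D x (mate M x) else 0) mm).
rewrite -big_split; apply: eq_bigr => x _ /=.
have [xm muK ne] := mm _ (ltn_ord x); rewrite muK.
have -> : mxdist D (mate M x) x = mxdist D x (mate M x).
  by rewrite /mxdist valK insubT sD.
by case: ltngtP ne; rewrite ?addr0 ?add0r.
Qed.
End Cost.

(** * The online step and its measurability *)

Section Algorithm.
Context {R : realType}.
Local Open Scope ring_scope.
Notation RxR := (measurableTypeR R * measurableTypeR R)%type.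
Implicit Types (dd : nat -> nat -> R) (k : int) (w : RxR).

(** Agreement at all scales from [k] on makes the classes nested, although the cells of different
    scales are not. *)
Definition same dd w k : rel nat := fun x y =>
  `[< forall n : nat, cell dd (k + n%:Z) w x = cell dd (k + n%:Z) w y >].

Lemma sameP dd w k x y : reflect (forall l, k <= l -> cell dd l w x = cell dd l w y)
  (same dd w k x y).
Proof.
apply: (iffP (asboolP _)) => h; last by move=> n; apply: h; rewrite lerDl.
by move=> l kl; have := h `|l - k|%N; rewrite gez0_abs ?subr_ge0 // subrKC.
Qed.

Lemma same_refl dd w k : reflexive (same dd w k).
Proof. by move=> x; apply/sameP. Qed.

Lemma same_sym dd w k : symmetric (same dd w k).
Proof. by move=> x y; apply/sameP/sameP => h l kl; rewrite h. Qed.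

Lemma same_trans dd w k : transitive (same dd w k).
Proof.
by move=> y x z /sameP xy /sameP yz; apply/sameP => l kl; rewrite xy // yz.
Qed.

Lemma same_mono dd w k l x y : k <= l -> same dd w k x y -> same dd w l x y.
Proof.
by move=> kl /sameP h; apply/sameP => j lj; apply: h; exact: le_trans lj.
Qed.

Lemma measurable_same dd k x y : measurable [set w : RxR | same dd w k x y]%classic.
Proof.
have -> : [set w : RxR | same dd w k x y]%classic =
  (\bigcap_(n : nat) [set w : RxR | cell dd (k + n%:Z) w x = cell dd (k + n%:Z) w y])%classic.
  apply/seteqP; split => w /=; first by move=> /asboolP h n _ /=.
  by move=> h; apply/asboolP => n; apply: h.
apply: bigcapT_measurable => n.
by apply: measurable_eq_fiber; exact: fiber_measurable_cell.
Qed.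

Definition admissible w m (D : 'M[R]_m) (M : {set {set 'I_m}}) : bool :=
  `[< balanced (same (mxdist D) w) m (mate M) >].

(** Balance at one level depends on finitely many measurable bits, and the levels are countable. *)
Lemma fiber_measurable_admissible m (D : 'M[R]_m) (M : {set {set 'I_m}}) :
  fiber_measurable (fun w : RxR => admissible w D M).
Proof.
apply: fiber_measurable_bool.
pose E w k x := [ffun y : 'I_m => same (mxdist D) w k x y].
pose ok (x : 'I_m) (p : {ffun 'I_m -> bool} * {ffun 'I_m -> bool}) :=
  let C y := if insub y is Some j then p.1 j else false in
  let C' y := if insub y is Some j then p.2 j else false in
  (crossings m (mate M) C <= maxn 1 (2 * psize m C - psize m C'))%N.
have okE w k (x : 'I_m) : ok x (E w k x, E w (next_level k) x) =
    (crossings m (mate M) (same (mxdist D) w k x)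
     <= cross_bound (same (mxdist D) w) m k x)%N.
  rewrite /ok /cross_bound.
  have C1 l y : (y < m)%N -> (if insub y is Some j then E w l x j else false) =
      same (mxdist D) w l x y.
    by move=> ym; rewrite insubT ffunE.
  congr (_ <= maxn _ (2 * _ - _))%N.
  - by apply: eq_bigr => y _; rewrite !C1 // mate_lt.
  - by apply: eq_bigr => y _; rewrite !C1.
  - by apply: eq_bigr => y _; rewrite !C1.
have -> : [set w : RxR | admissible w D M]%classic =
   (\bigcap_(n : nat) \bigcap_(x in [set: 'I_m])
    [set w : RxR | ok x (E w (odflt 0 (unpickle n)) x,
                         E w (next_level (odflt 0 (unpickle n))) x)])%classic.
  apply/seteqP; split => w /=.
    by move=> /asboolP bal n _ x _ /=; rewrite okE; apply: bal.
  move=> h; apply/asboolP => k x xm.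
  by have := h (pickle k) I (Ordinal xm) I; rewrite /= pickleK /= okE.
apply: bigcapT_measurable => n; apply: fin_bigcap_measurable.
  exact: finite_finset.
have mE l (x : 'I_m) : fiber_measurable (fun w : RxR => E w l x).
  apply: fiber_measurable_ffun => y; apply: fiber_measurable_bool.
  exact: measurable_same.
move=> x _; exact: (fiber_measurable_comp (ok x)
  (fiber_measurable_pair (mE _ x) (mE _ x)) true).
Qed.

Definition swap (x : nat) : nat := if odd x then x.-1 else x.+1.

Lemma swap_matching i : fun_matching i.*2 swap.
Proof.
move=> x xi; rewrite /swap; case: (boolP (odd x)) => ox.
  have x0 : (0 < x)%N by case: x ox {xi}.
  have ox1 : odd x.-1 = false by apply/negbTE; case: x ox {xi x0} => //= x; rewrite negbK.
  rewrite ox1 prednK //; split => //; first exact: ltnW.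
  by rewrite neq_ltn prednK // leqnn.
rewrite /= ox /=; split => //; last by rewrite neq_ltn ltnSn orbT.
rewrite ltn_neqAle xi andbT; apply: contra ox => /eqP e.
by have := odd_double i; rewrite -e /= => /negbFE.
Qed.

(* An admissible matching always beats the others, as at most #|M| edges are deleted. *)
Definition step w i (D : 'M[R]_(i.+1.*2)) (M : {set {set 'I_(i.*2)}}) :
    {set {set 'I_(i.+1.*2)}} :=
  [arg min_(M' < matching_of i.+1.*2 swap | perfect_matching M')
    (if admissible w D M' then #|deleted_edges M M'| else #|M|.+1)].

Definition ulsub i (D : 'M[R]_(i.+1.*2)) : 'M[R]_(i.*2) :=
  \matrix_(j, k) D (widen_ord (leq_doubleS i) j) (widen_ord (leq_doubleS i) k).

Fixpoint run w i : 'M[R]_(i.*2) -> {set {set 'I_(i.*2)}} :=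
  match i with
  | 0 => fun=> matching_of 0 swap
  | i'.+1 => fun D => step w D (run w (ulsub D))
  end.

Lemma step_perfect w i (D : 'M[R]_(i.+1.*2)) M : perfect_matching (step w D M).
Proof.
rewrite /step; case: arg_minnP => //; apply: matching_of_perfect.
exact: swap_matching.
Qed.

Lemma run_perfect w i (D : 'M[R]_(i.*2)) : perfect_matching (run w D).
Proof.
case: i D => [|i] D /=; last exact: step_perfect.
by apply: matching_of_perfect; exact: (@swap_matching 0).
Qed.

(** Any admissible candidate passes its guarantee on to the minimizer, so the algorithm need not
    carry out the repair itself. *)
Lemma step_optimal w i (D : 'M[R]_(i.+1.*2)) M M' b :
  perfect_matching M' -> admissible w D M' -> (#|deleted_edges M M'| <= b)%N ->
  admissible w D (step w D M) /\ (#|deleted_edges M (step w D M)| <= b)%N.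
Proof.
move=> pM' aM' db; rewrite /step.
case: arg_minnP => [|M1 pM1 mn]; first by apply: matching_of_perfect; exact: swap_matching.
have := mn M' pM'; rewrite aM'.
have dM : (#|deleted_edges M M'| <= #|M|)%N.
  by apply: subset_leq_card; apply/fintype.subsetP => e; rewrite inE => /andP[].
case: ifP => [_ h|_ h]; first by split => //; exact: leq_trans h db.
by have := leq_trans h dM; rewrite ltnn.
Qed.

Lemma fiber_measurable_run i (D : 'M[R]_(i.*2)) :
  fiber_measurable (fun w : RxR => run w D).
Proof.
elim: i D => [|i IH] D /=; first exact: fiber_measurable_cst.
pose adm w := [ffun M' : {set {set 'I_(i.+1.*2)}} => admissible w D M'].
pose f (p : {ffun {set {set 'I_(i.+1.*2)}} -> bool} * {set {set 'I_(i.*2)}}) :=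
  [arg min_(M' < matching_of i.+1.*2 swap | perfect_matching M')
    (if p.1 M' then #|deleted_edges p.2 M'| else #|p.2|.+1)].
have -> : (fun w : RxR => step w D (run w (ulsub D))) =
          (fun w : RxR => f (adm w, run w (ulsub D))).
  apply/funext => w; rewrite /f /step /=; congr (fintype.arg_min _ _ _).
  by apply/funext => M'; rewrite ffunE.
apply: fiber_measurable_comp; apply: fiber_measurable_pair; last exact: IH.
by apply: fiber_measurable_ffun => M'; exact: fiber_measurable_admissible.
Qed.

Definition algorithm : randomized_algorithm R RxR :=
  RandomizedAlgorithm (fun w i D => @run_perfect w i D)
    (fun i D M => @fiber_measurable_run i D M).

Section Metric.
Variables (X : metricType R) (s : nat -> X).
Let dd x y := mdist (s x) (s y).

Lemma mxdist_revealed i x y : (x < i.*2)%N -> (y < i.*2)%N ->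
  mxdist (revealed s i) x y = dd x y.
Proof. by move=> xi yi; rewrite /mxdist !insubT mxE. Qed.

(** Cells depend only on distances among points up to the given one, all of them revealed. *)
Lemma same_revealed i w k x y : (x < i.*2)%N -> (y < i.*2)%N ->
  same (mxdist (revealed s i)) w k x y = same dd w k x y.
Proof.
move=> xi yi; have e l z : (z < i.*2)%N ->
    cell (mxdist (revealed s i)) l w z = cell dd l w z.
  move=> zi; apply: eq_cell => u v uz vz.
  by rewrite mxdist_revealed // (leq_ltn_trans _ zi).
by apply/sameP/sameP => h l kl; move: (h l kl); rewrite !e.
Qed.

Lemma balanced_revealed i w mu : fun_matching i.*2 mu ->
  balanced (same (mxdist (revealed s i)) w) i.*2 mu <-> balanced (same dd w) i.*2 mu.
Proof.
move=> mm.
have e k x : (x < i.*2)%N ->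
    (crossings i.*2 mu (same (mxdist (revealed s i)) w k x) <=
     cross_bound (same (mxdist (revealed s i)) w) i.*2 k x)%N =
    (crossings i.*2 mu (same dd w k x) <= cross_bound (same dd w) i.*2 k x)%N.
  move=> xi; rewrite /cross_bound; congr (_ <= maxn _ (2 * _ - _))%N.
  - apply: eq_bigr => y _; rewrite !same_revealed //.
    by case: (mm _ (ltn_ord y)).
  - by apply: eq_bigr => y _; rewrite !same_revealed.
  - by apply: eq_bigr => y _; rewrite !same_revealed.
by split => bal k x xi; have := bal k x xi; rewrite e.
Qed.

Lemma ulsub_revealed i : ulsub (revealed s i.+1) = revealed s i.
Proof. by apply/matrixP => j k; rewrite !mxE. Qed.

Lemma matchingS w i : matching algorithm s w i.+1 =
  step w (revealed s i.+1) (matching algorithm s w i).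
Proof. by rewrite /matching /= ulsub_revealed. Qed.

(** The repaired matching of [insert_pair] serves as the admissible candidate. *)
Lemma insert_revealed w i (S : nat -> seq int) :
  balanced (same dd w) i.*2 (mate (matching algorithm s w i)) ->
  (forall p k, p \in [:: i.*2; i.*2.+1] -> doubling (same dd w) i.*2 k p -> k \in S p) ->
  balanced (same dd w) i.+1.*2 (mate (matching algorithm s w i.+1)) /\
  (#|deleted_edges (matching algorithm s w i) (matching algorithm s w i.+1)| <=
    8 * (size (S i.*2) + size (S i.*2.+1)))%N.
Proof.
move=> bal hS; set M := matching algorithm s w i.
have pM : perfect_matching M by exact: output_perfect.
have mM := mate_matching pM.
have [mu [mm bal' ch]] := insert_pair (@same_sym dd w)
  (@same_trans dd w) (@same_mono dd w) mM bal hS.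
have pM' := @matching_of_perfect i.+1.*2 mu mm.
have aM' : admissible w (revealed s i.+1) (matching_of i.+1.*2 mu).
  apply/asboolP; apply/balanced_revealed; first exact: mate_matching.
  move=> k x xi; have := bal' k x xi; congr (_ <= _)%N.
  apply: eq_bigr => y _; by rewrite mate_matching_of.
have := step_optimal (M := M) pM' aM' (leq_trans (deleted_edges_le pM mm) ch).
rewrite -matchingS => -[adm del]; split => //.
by move/asboolP: adm => /balanced_revealed; apply; apply: mate_matching; exact: output_perfect.
Qed.
End Metric.
End Algorithm.

(** * Recourse and cost *)

Section Levels.
Context {R : realType}.
Local Open Scope ring_scope.
Notation RxR := (measurableTypeR R * measurableTypeR R)%type.
Variables (X : metricType R) (s : nat -> X) (n : nat) (a : int) (T : nat).
Let dd x y := mdist (s x) (s y).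
Hypothesis lo : forall x y, (x < n.*2)%N -> (y < n.*2)%N -> dd x y != 0 ->
  2 * scale a < dd x y.
Hypothesis hi : forall x y, (x < n.*2)%N -> (y < n.*2)%N ->
  dd x y <= scale (a + T%:Z) / 2.
Implicit Types (w : RxR) (k : int).

Lemma same_low w k x y : (x < n.*2)%N -> (y < n.*2)%N -> k <= a ->
  same dd w k x y -> dd x y = 0.
Proof.
move=> xn yn ka /sameP/(_ k (lexx _)) e; apply/eqP.
apply/negP => /negP /(lo xn yn); rewrite ltNge => /negP; apply.
apply: le_trans (cell_diam e) _; rewrite ler_pM2l //; exact: le_scale.
Qed.

Lemma same_dist0 w k x y : dd x y = 0 -> same dd w k x y.
Proof. by move=> e; apply/sameP => l _; exact: cell_eq0. Qed.

Lemma cell_high w k x y : (x < n.*2)%N -> (y < n.*2)%N -> a + T%:Z <= k ->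
  cell dd k w x = cell dd k w y.
Proof.
move=> xn yn ak; have n0 : (0 < n.*2)%N by exact: leq_ltn_trans xn.
have h z : (z < n.*2)%N -> dd 0%N z <= scale k / 2.
  move=> zn; apply: le_trans (hi n0 zn) _.
  by rewrite ler_pM2r ?invr_gt0 // le_scale.
by rewrite !cell_top //; exact: h.
Qed.

Lemma same_high w k x y : (x < n.*2)%N -> (y < n.*2)%N -> a + T%:Z <= k ->
  same dd w k x y.
Proof. by move=> xn yn ak; apply/sameP => l kl; apply: cell_high => //; exact: le_trans kl. Qed.

(** Below level [a] the parent of [p] holds only points at distance 0 from [p], and from [a + T] on
    the class holds all points. In both cases class and parent have the same old points, which rules
    out a doubling. *)
Lemma doubling_level w i k p : (i < n)%N -> p \in [:: i.*2; i.*2.+1] ->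
  doubling (same dd w) i.*2 k p -> a <= k < a + T%:Z.
Proof.
move=> iN pi dbl.
have i2 : (i.*2.+1 < n.*2)%N by rewrite -ltnS -doubleS ltnS; lia.
have pn : (p < n.*2)%N by move: pi; rewrite !inE => /orP[]/eqP->; [exact: ltnW|].
have yn (y : 'I_(i.*2)) : (y < n.*2)%N.
  by apply: leq_trans (ltn_ord y) _; rewrite leq_double ltnW.
have contra : (forall y : 'I_(i.*2), same dd w (next_level k) p y -> same dd w k p y) -> False.
  move=> h; move: dbl => /andP[]; set A := psize _ _; set B := psize _ _.
  have : (B <= A)%N.
    apply: leq_sum => y _; move: (h y).
    by case: (same dd w (next_level k) p y) => // ->.
  lia.
apply/andP; split.
  rewrite leNgt; apply/negP => ka; apply: contra => y h.
  by apply: same_dist0; apply: same_low h => //; rewrite /next_level -lezD1 in ka *.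
rewrite ltNge; apply/negP => ka; apply: contra => y _; exact: same_high.
Qed.

Definition doubling_levels w i p : seq int :=
  [seq a + t%:Z | t <- iota 0 T & doubling (same dd w) i.*2 (a + t%:Z) p].

Lemma doubling_levelsP w i k p : (i < n)%N -> p \in [:: i.*2; i.*2.+1] ->
  doubling (same dd w) i.*2 k p -> k \in doubling_levels w i p.
Proof.
move=> iN pi dbl; have /andP[ak kT] := doubling_level iN pi dbl.
have e : k = a + `|k - a|%N%:Z by rewrite gez0_abs ?subr_ge0 // subrKC.
rewrite e; apply: map_f; rewrite mem_filter -e dbl mem_iota add0n /=.
by rewrite -ltz_nat gez0_abs ?subr_ge0 // ltrBlDl.
Qed.

Lemma size_doubling_levels w i p : (size (doubling_levels w i p) <= T)%N.
Proof.
by rewrite size_map size_filter; apply: leq_trans (count_size _ _) _; rewrite size_iota.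
Qed.

Lemma exp_doubling_levels w i p :
  (2 ^ size (doubling_levels w i p) <= maxn 1 (2 * i.*2))%N.
Proof.
rewrite size_map size_filter.
pose c t := psize i.*2 (same dd w (a + t%:Z) p).
have nextE t : next_level (a + t%:Z) = a + t.+1%:Z by rewrite /next_level -addrA -PoszD addn1.
have := @count_doublings c T.
rewrite (@eq_count _ _ (fun t => doubling (same dd w) i.*2 (a + t%:Z) p)); last first.
  by move=> t; rewrite /doubling nextE.
move=> h; apply: leq_trans (h _) _.
  by move=> t; apply: leq_psize_sub => y; apply: same_mono; rewrite lerD2l lez_nat.
by rewrite geq_max leq_maxl leq_max leq_mul2l /c leq_psize !orbT.
Qed.

Lemma matching_balanced w i : (i <= n)%N ->
  balanced (same dd w) i.*2 (mate (matching (algorithm (R := R)) s w i)).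
Proof.
elim: i => [|i IH] iN; first by move=> k x; rewrite ltn0.
have := insert_revealed (S := doubling_levels w i) (IH (ltnW iN)).
case=> // p k pi; exact: doubling_levelsP.
Qed.

Lemma deleted_le w i b : (i < n)%N ->
  (forall p, (size (doubling_levels w i p) <= b)%N) ->
  (#|deleted_edges (matching (algorithm (R := R)) s w i)
     (matching (algorithm (R := R)) s w i.+1)| <= 16 * b)%N.
Proof.
move=> iN hb.
have [_] := insert_revealed (S := doubling_levels w i) (matching_balanced w (ltnW iN))
  (fun p k pi => @doubling_levelsP w i k p iN pi).
move=> /leq_trans; apply; have := hb i.*2; have := hb i.*2.+1; lia.
Qed.

(** The term of the last level at which [x] and [y] are apart suffices: one level higher they share
    a cell, of diameter at most [2 * scale (k + 1) = 4 * scale k]. *)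
Lemma dist_le_levels w x y : (x < n.*2)%N -> (y < n.*2)%N ->
  dd x y <= \sum_(t < T) 4 * scale (a + t%:Z) *
    (~~ same dd w (a + t%:Z) x y && same dd w (next_level (a + t%:Z)) x y)%:R.
Proof.
move=> xn yn; have sc0 k : 0 <= scale k :> R by exact: ltW (scale_gt0 _).
have ge0 (t : 'I_T) : 0 <= 4 * scale (a + t%:Z) *
    (~~ same dd w (a + t%:Z) x y && same dd w (next_level (a + t%:Z)) x y)%:R :> R.
  by rewrite !mulr_ge0.
have [->|ne] := eqVneq (dd x y) 0; first by rewrite sumr_ge0.
have ex : exists t : nat, same dd w (a + t%:Z) x y by exists T; exact: same_high.
case: (ex_minnP ex) => t st mn.
case: t st mn => [|t] st mn.
  by move: ne; rewrite (same_low xn yn _ st) ?eqxx // addr0.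
have tT : (t < T)%N by apply: mn; exact: same_high.
have nst : ~~ same dd w (a + t%:Z) x y by apply/negP => /mn; rewrite ltnn.
have nE : next_level (a + t%:Z) = a + t.+1%:Z by rewrite /next_level -addrA -PoszD addn1.
rewrite (bigD1 (Ordinal tT)) //= nst nE st mulr1.
rewrite -[leLHS]addr0 lerD ?sumr_ge0 //.
move/sameP/(_ _ (lexx _)): st => /cell_diam.
by rewrite -nE /next_level scaleS mulrA -natrM.
Qed.

Lemma sum_scale (j : nat) : \sum_(t < j.+1) scale (a + t%:Z) <= 2 * scale (a + j%:Z) :> R.
Proof.
elim: j => [|j IH].
  by rewrite big_ord1 mulr_natl mulr2n lerDl ltW // scale_gt0.
have sS : scale (a + j.+1%:Z) = 2 * scale (a + j%:Z) :> R.
  by rewrite -addn1 PoszD addrA scaleS.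
rewrite big_ord_recr /= sS.
have := scale_gt0 (R := R) (a + j%:Z); move: IH; lra.
Qed.

(** Points of different classes lie in different cells at some scale from [t] on, and [cell_high]
    limits that scale to the range. *)
Lemma not_same_le w (t : 'I_T) x y : (x < n.*2)%N -> (y < n.*2)%N ->
  ((~~ same dd w (a + t%:Z) x y)%:R : R) <=
  \sum_(j < T | (t <= j)%N) (cell dd (a + j%:Z) w x != cell dd (a + j%:Z) w y)%:R.
Proof.
move=> xn yn; have [_|ns] := boolP (same _ _ _ _ _); first by rewrite sumr_ge0.
have [j tj ne] : exists2 j : 'I_T, (t <= j)%N &
    cell dd (a + j%:Z) w x != cell dd (a + j%:Z) w y.
  apply/exists_inP; apply: contraNT ns => /exists_inPn h.
  apply/sameP => l tl; have [lT|] := ltP l (a + T%:Z); last exact: cell_high.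
  have al : a <= l by apply: le_trans tl; rewrite lerDl.
  have e : l = a + `|l - a|%N%:Z by rewrite gez0_abs ?subr_ge0 // subrKC.
  have jT : (`|l - a| < T)%N by rewrite -ltz_nat gez0_abs ?subr_ge0 // ltrBlDl.
  rewrite e; apply/eqP/negPn; apply: (h (Ordinal jT)) => /=.
  by rewrite unfold_in /= -lez_nat gez0_abs ?subr_ge0 // lerBrDl.
rewrite (bigD1 j) //= ne -[leLHS]addr0 lerD ?sumr_ge0 //.
Qed.

(** Combines [dist_le_levels] for the maintained matching, [split_count] to pass to [M], and
    [not_same_le] to pass from classes to cells. *)
Lemma cost_le w i (M : {set {set 'I_(i.*2)}}) : (i <= n)%N -> perfect_matching M ->
  cost (revealed s i) (matching (algorithm (R := R)) s w i) <=
  \sum_(x < i.*2) \sum_(j < T) 8 * scale (a + j%:Z) *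
    (cell dd (a + j%:Z) w x != cell dd (a + j%:Z) w (mate M x))%:R.
Proof.
move=> iN pM; pose mu := mate (matching (algorithm (R := R)) s w i); pose nu := mate M.
have pM0 : perfect_matching (matching (algorithm (R := R)) s w i) by exact: output_perfect.
have mm : fun_matching i.*2 mu := mate_matching pM0.
have nn : fun_matching i.*2 nu := mate_matching pM.
have lt x : (x < i.*2)%N -> (x < n.*2)%N.
  by move=> /leq_trans; apply; rewrite leq_double.
have lmu (x : 'I_(i.*2)) : (mu x < i.*2)%N by case: (mm _ (ltn_ord x)).
have lnu (x : 'I_(i.*2)) : (nu x < i.*2)%N by case: (nn _ (ltn_ord x)).
have sc0 k : 0 <= scale k :> R by exact: ltW (scale_gt0 _).
have sym u v : revealed s i u v = revealed s i v u.
  by rewrite !mxE; exact: metric_sym.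
have costE := cost_mate pM0 sym.
rewrite -(ler_pM2l (_ : 0 < 2)) // costE.
have -> : \sum_(x < i.*2) mxdist (revealed s i) x (mu x) = \sum_(x < i.*2) dd x (mu x).
  by apply: eq_bigr => x _; rewrite mxdist_revealed.
apply: le_trans (ler_sum _ (fun x _ => dist_le_levels w (lt _ (ltn_ord x)) (lt _ (lmu x)))) _.
rewrite exchange_big /=.
apply: (@le_trans _ _ (\sum_(t < T) 4 * scale (a + t%:Z) *
   (2 * \sum_(x < i.*2) (~~ same dd w (a + t%:Z) x (nu x))%:R))).
  apply: ler_sum => t _; rewrite -mulr_sumr ler_wpM2l ?mulr_ge0 //.
  rewrite -!natr_sum -natrM ler_nat.
  exact: (split_count (@same_refl _ dd w) (@same_sym _ dd w) (@same_trans _ dd w)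
    (@same_mono _ dd w) (a + t%:Z) mm nn (matching_balanced w iN)).
apply: (@le_trans _ _ (\sum_(t < T) 8 * scale (a + t%:Z) *
   (\sum_(x < i.*2) \sum_(j < T | (t <= j)%N)
      (cell dd (a + j%:Z) w x != cell dd (a + j%:Z) w (nu x))%:R))).
  apply: ler_sum => t _; rewrite mulrA [_ * 2]mulrC mulrA -natrM.
  rewrite ler_wpM2l ?mulr_ge0 //; apply: ler_sum => x _.
  by apply: not_same_le; apply: lt.
(* After exchanging the sums, a cut at scale [j] is charged by all levels [t <= j]; their scales
   form a geometric sum, at most twice the largest. *)
under [leLHS]eq_bigr do rewrite mulr_sumr.
rewrite exchange_big /= mulr_sumr; apply: ler_sum => x _.
under [leLHS]eq_bigr do rewrite mulr_sumr.
rewrite (exchange_big_dep xpredT) //= mulr_sumr; apply: ler_sum => j _.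
rewrite -mulr_suml mulrA ler_wpM2r // -mulr_sumr.
rewrite (mulrCA 2) ler_pM2l //.
apply: le_trans (sum_scale j).
by rewrite (big_ord_widen T (fun t => scale (a + t%:Z))).
Qed.
End Levels.

(** * The range of levels, the constants and the final bounds *)

Section Final.
Context {R : realType}.
Local Open Scope ring_scope.
Notation RxR := (measurableTypeR R * measurableTypeR R)%type.

Lemma ln2_ge : (1 / 2 : R) <= ln 2.
Proof.
have := @le_ln1Dx R (- (1 / 2)) ltac:(lra).
have -> : 1 + - (1 / 2) = (2 : R)^-1 by lra.
rewrite lnV ?posrE //; lra.
Qed.

Lemma integer_log (y : R) : 0 < y -> exists f : int, scale f <= y < 2 * scale f.
Proof.
move=> y0; have l2 : 0 < ln 2 :> R by rewrite ln_gt0 // ltr1n.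
pose f := Num.floor (ln y / ln 2); exists f.
have pE (z : int) : scale z = expR (z%:~R * ln 2) :> R.
  by rewrite -ln_powR lnK ?posrE ?powR_gt0 // powR_intmul.
rewrite -scaleS !pE -[y]lnK ?posrE // ler_expR ltr_expR.
rewrite -ler_pdivlMr // -ltr_pdivrMr //.
exact: floor_itv.
Qed.

Section Range.
Variables (X : metricType R) (s : nat -> X) (n : nat).
Let dd x y := mdist (s x) (s y).
Let D := revealed s n.

Lemma dist_le_max x y : (x < n.*2)%N -> (y < n.*2)%N -> dd x y <= max_dist D.
Proof.
move=> xn yn; have -> : dd x y = D (Ordinal xn) (Ordinal yn) by rewrite mxE.
exact: (le_bigmax _ (fun p : 'I_(n.*2) * 'I_(n.*2) => D p.1 p.2) (Ordinal xn, Ordinal yn)).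
Qed.

Lemma min_le_dist x y : (x < n.*2)%N -> (y < n.*2)%N -> dd x y != 0 ->
  min_nonzero_dist D <= dd x y.
Proof.
move=> xn yn; have -> : dd x y = D (Ordinal xn) (Ordinal yn) by rewrite mxE.
move=> ne; exact: (bigmin_le_cond (j := (Ordinal xn, Ordinal yn)) _ (fun p : 'I_(n.*2) * 'I_(n.*2) => D p.1 p.2)).
Qed.

(** Only logarithmically many levels matter. The last clause supplies the two distinct points that
    [doubling_dim_ge1] asks for. *)
Lemma level_range : exists (a : int) (T : nat),
  [/\ forall x y, (x < n.*2)%N -> (y < n.*2)%N -> dd x y != 0 -> 2 * scale a < dd x y,
      forall x y, (x < n.*2)%N -> (y < n.*2)%N -> dd x y <= scale (a + T%:Z) / 2,
      T%:R <= 5 * (1 + ln (aspect_ratio D)),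
      0 <= 1 + ln (aspect_ratio D) &
      (0 < T)%N -> exists x y : X, x != y].
Proof.
have mx0 : 0 <= max_dist D by exact: bigmax_ge_id.
have [M0|Mn0] := eqVneq (max_dist D) 0.
  have z x y : (x < n.*2)%N -> (y < n.*2)%N -> dd x y = 0.
    move=> xn yn; apply/eqP; rewrite eq_le mdist_ge0 andbT -M0; exact: dist_le_max.
  (* All distances are 0: there are no levels, and [ln] of the aspect ratio 0 is 0. *)
  exists 0, 0%N; rewrite /aspect_ratio M0 mul0r ln0 // !addr0 mulr1; split => //.
  - by move=> x y xn yn; rewrite z // eqxx.
  - by move=> x y xn yn; rewrite z // divr_ge0 // ltW // scale_gt0.
have M0 : 0 < max_dist D by rewrite lt_neqAle eq_sym Mn0.
have m0 : 0 < min_nonzero_dist D.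
  apply/bigmin_gtP; split => // p pn; rewrite lt_neqAle eq_sym pn.
  by rewrite mxE mdist_ge0.
have mM : min_nonzero_dist D <= max_dist D by exact: bigmin_le_id.
set Phi := aspect_ratio D.
have Phi1 : 1 <= Phi by rewrite ler_pdivlMr // mul1r.
have lP : 0 <= ln Phi by exact: ln_ge0.
have l2 : 0 < ln 2 :> R by rewrite ln_gt0 // ltr1n.
have [f /andP[f1 f2]] := integer_log m0.
pose N := (Num.truncn (ln Phi / ln 2)).+1.
(* Two levels below [f], [2 * scale a] is half of [scale f], which is at most the minimal distance.
   The maximal distance is at most [2 ^ N * (2 * scale f)], that is [2 ^ (N + 4) * scale a / 2]. *)
exists (f - 2), (N + 4)%N.
have s2 : scale f = 4 * scale (f - 2) :> R.
  by rewrite -[in LHS](subrK 2 f) -[2]/(1 + 1) addrA !scaleS mulrA -natrM.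
have s4 k (j : nat) : scale (k + j%:Z) = 2 ^+ j * scale k :> R.
  elim: j => [|j IH]; first by rewrite addr0 mul1r.
  by rewrite -[in LHS]addn1 PoszD addrA scaleS IH exprS mulrA.
split.
- move=> x y xn yn ne; apply: lt_le_trans (min_le_dist xn yn ne).
  apply: lt_le_trans f1; rewrite s2; have := scale_gt0 (R := R) (f - 2); lra.
- move=> x y xn yn; apply: le_trans (dist_le_max xn yn) _.
  rewrite s4 exprD.
  have PN : Phi <= 2 ^+ N.
    rewrite -ler_ln ?posrE ?exprn_gt0 //; last by apply: lt_le_trans Phi1.
    by rewrite lnXn // -[leRHS]mulr_natl -ler_pdivrMr // ltW // truncnS_gt.
  have ME : max_dist D = Phi * min_nonzero_dist D by rewrite divfK // gt_eqF.
  rewrite ME; apply: (@le_trans _ _ (2 ^+ N * (2 * scale f))).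
    by apply: ler_pM => //; [exact: le_trans Phi1|exact: ltW|exact: ltW].
  have e16 : 2 ^+ 4 = 16 :> R by rewrite -natrX.
  rewrite s2 e16; move: (2 ^+ N) (scale (f - 2)) => u v.
  by rewrite [leRHS](_ : _ = u * (2 * (4 * v))) //; field.
- rewrite /N natrD -natr1.
  have : (Num.truncn (ln Phi / ln 2))%:R <= ln Phi / ln 2.
    by rewrite truncn_le divr_ge0 // ltW.
  have : ln Phi / ln 2 <= 2 * ln Phi.
    rewrite ler_pdivrMr // mulrAC ler_peMl //; have := ln2_ge; lra.
  lra.
- lra.
- move=> _; have [p pn] : exists p : 'I_(n.*2) * 'I_(n.*2), D p.1 p.2 != 0.
    apply/existsP; apply: contraT => /existsPn z; move: Mn0.
    have -> : max_dist D = 0; last by rewrite eqxx.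
    apply/eqP; rewrite eq_le mx0 andbT; apply/bigmax_leP; split => // p _.
    by have /negPn/eqP -> := z p.
  exists (s p.1), (s p.2); apply: contra pn => /eqP e.
  by rewrite mxE e mdistxx.
Qed.
End Range.

Lemma fiber_measurable_real d (T : measurableType d) (U : finType) (f : T -> U) (g : U -> R) :
  fiber_measurable f -> measurable_fun setT (fun t => g (f t)).
Proof.
move=> mf _ B mB; rewrite setTI.
have -> : ((fun t => g (f t)) @^-1` B)%classic =
    (\bigcup_(u in [set u | B (g u)]) [set t | f t = u])%classic.
  by apply/seteqP; split => [t /= h|t [u /= h fu] /=]; [exists (f t)|rewrite fu].
by apply: fin_bigcup_measurable => //; exact: finite_finset.
Qed.

Lemma integral_sum_indic_le d (T : measurableType d) (P : probability T R)
    (I : finType) (c q : I -> R) (b : I -> T -> bool) :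
  (forall i, 0 <= c i) -> (forall i, measurable [set t | b i t]%classic) ->
  (forall i, (P [set t | b i t]%classic <= (q i)%:E)%E) ->
  (\int[P]_t (\sum_i c i * (b i t)%:R)%:E <= (\sum_i c i * q i)%:E)%E.
Proof.
move=> c0 mb Pb.
have indE i t : (c i * (b i t)%:R)%:E = ((c i)%:E * (\1_[set t | b i t]%classic t)%:E)%E.
  rewrite -EFinM indicE; congr (_ * _)%:E.
  case: (boolP (b i t)) => h; first by rewrite mem_set.
  by rewrite memNset //=; apply/negP.
under eq_integral do rewrite -sumEFin.
have mI i : measurable_fun setT (EFin \o (\1_[set t | b i t]%classic : T -> R)).
  by apply/measurable_EFinP; exact: measurable_indic.
rewrite ge0_integral_sum //.
- rewrite -sumEFin; apply: lee_sum => i _.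
  rewrite (eq_integral (fun t => (c i)%:E * (\1_[set t | b i t]%classic t)%:E)%E) => [|t _]; last exact: indE.
  rewrite ge0_integralZl_EFin => [||t _|//|//]; [|exact: measurableT|by rewrite lee_fin indicE|exact: mI].
  rewrite integral_indic // setIT EFinM; apply: lee_wpmul2l; [by rewrite lee_fin|exact: Pb].
- move=> i; rewrite (_ : (fun t => _) = (fun t => (c i)%:E * (\1_[set t | b i t]%classic t)%:E)%E); last first.
    by apply/funext => t; rewrite indE.
  by apply: measurable_funeM; exact: mI.
- by move=> i t _; rewrite lee_fin mulr_ge0.
Qed.

Lemma doubling_dim_ge0 (X : metricType R) (ddim : R) (x : X) :
  has_doubling_dim X ddim -> 0 <= ddim.
Proof.
move=> hX; have [c hc cov] := hX x 1 ltr01.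
have /cov[y /= yc _] : ball x (2 * 1) x by rewrite ballEmdist /= mdistxx mulr1.
have c1 : (1 <= size c)%N by case: (c) yc.
rewrite leNgt; apply/negP => d0.
have : 1 <= 2 `^ ddim by apply: le_trans hc; rewrite ler1n.
by rewrite -ler_ln ?posrE ?powR_gt0 // ln1 ln_powR leNgt nmulr_rlt0 // ln_gt0 // ltr1n.
Qed.

Lemma cost_ge0 m (D : 'M[R]_m) M : (forall i j, 0 <= D i j) -> 0 <= cost D M.
Proof. by move=> D0; apply: sumr_ge0 => i _; apply: sumr_ge0. Qed.

(** The expected cost is compared with each fixed perfect matching [M], and the infimum over [M] is
    taken at the end. *)
Lemma algorithm_competitive (X : metricType R) (ddim : R) n (s : nat -> X) :
  has_doubling_dim X ddim ->
  expected_competitive coins algorithm s n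
    (20000 * (ddim * (1 + ln (aspect_ratio (revealed s n))))).
Proof.
move=> hX i iN.
have [a [T [lo hi TP Phi0 ne]]] := level_range s n.
have dim0 : 0 <= ddim by exact: doubling_dim_ge0 (s 0%N) hX.
have D0 (j k : 'I_(i.*2)) : 0 <= revealed s i j k by rewrite mxE mdist_ge0.
have sym (j k : 'I_(i.*2)) : revealed s i j k = revealed s i k j.
  by rewrite !mxE metric_sym.
pose F w := cost (revealed s i) (matching (algorithm (R := R)) s w i).
have F0 w : 0 <= F w by exact: cost_ge0.
have mF : measurable_fun setT F.
  exact: (fiber_measurable_real (cost (revealed s i)) (@fiber_measurable_run R i (revealed s i))).
(* Each point and level contributes [8 * 240 = 1920] times [ddim] and the distance to its partner in
   [M]; the sum over the points counts every edge twice. As [T] is at most five times the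
   logarithmic factor, the total constant is 19200. *)
have key M : perfect_matching M ->
    (\int[coins]_w (F w)%:E <= (3840 * T%:R * ddim * cost (revealed s i) M)%:E)%E.
  move=> pM; pose nu := mate M; have nn : fun_matching i.*2 nu := mate_matching pM.
  pose I := ('I_(i.*2) * 'I_T)%type.
  pose c (p : I) : R := 8 * scale (a + p.2%:Z).
  pose b (p : I) (w : RxR) := cell (fun x y => mdist (s x) (s y)) (a + p.2%:Z) w p.1
    != cell (fun x y => mdist (s x) (s y)) (a + p.2%:Z) w (nu p.1).
  pose q (p : I) : R := 240 * ddim * mdist (s p.1) (s (nu p.1)) / scale (a + p.2%:Z).
  have c0 p : 0 <= c p by rewrite mulr_ge0 // ltW // scale_gt0.
  have mb p : measurable [set w | b p w]%classic.
    rewrite (_ : [set w | _]%classic = ~` [set w : RxR |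
       cell (fun x y => mdist (s x) (s y)) (a + p.2%:Z) w p.1 =
       cell (fun x y => mdist (s x) (s y)) (a + p.2%:Z) w (nu p.1)])%classic.
      by apply: measurableC; apply: measurable_eq_fiber; exact: fiber_measurable_cell.
    by apply/seteqP; split => w /= /eqP.
  have Pb p : (coins [set w | b p w]%classic <= (q p)%:E)%E.
    apply: cell_cut_prob => //.
    have [x [y xy]] := ne (leq_ltn_trans (leq0n _) (ltn_ord p.2)).
    exact: (doubling_dim_ge1 hX xy).
  apply: (@le_trans _ _ (\int[coins]_w (\sum_p c p * (b p w)%:R)%:E)%E).
    apply: ge0_le_integral => //.
    - by move=> w _; rewrite lee_fin.
    - exact/measurable_EFinP.
    - apply/measurable_EFinP; apply: measurable_sum => p.
      apply: measurable_funM => //.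
      apply: (fiber_measurable_real (fun b : bool => b%:R)).
      by apply: fiber_measurable_bool; exact: mb.
    - move=> w _; rewrite lee_fin /F.
      apply: le_trans (cost_le lo hi w iN pM) _.
      by rewrite pair_big.
  apply: le_trans (integral_sum_indic_le c0 mb Pb) _.
  rewrite lee_fin -(pair_big xpredT xpredT (fun x t => c (x, t) * q (x, t))) /=.
  have cq x t : c (x, t) * q (x, t) = 1920 * ddim * mdist (s x) (s (nu x)).
    by rewrite /c /q /=; field; rewrite gt_eqF // scale_gt0.
  have -> : \sum_x \sum_t c (x, t) * q (x, t) =
      1920 * T%:R * ddim * \sum_(x < i.*2) mxdist (revealed s i) x (nu x).
    rewrite mulr_sumr; apply: eq_bigr => x _.
    under eq_bigr do rewrite cq.
    rewrite sumr_const card_ord -mulr_natl mxdist_revealed //.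
      by ring.
    by case: (nn _ (ltn_ord x)).
  by rewrite -cost_mate // mulrA; lra.
rewrite unlock; pose C' := 3840 * T%:R * ddim.
have C'0 : 0 <= C'.
  by apply: mulr_ge0; [apply: mulr_ge0; exact: ler0n|exact: dim0].
have pD : perfect_matching (matching_of i.*2 swap).
  by apply: matching_of_perfect; exact: swap_matching.
have opt0 : 0 <= opt (revealed s i).
  apply: lb_le_inf; first by exists (cost (revealed s i) (matching_of i.*2 swap)); exists (matching_of i.*2 swap).
  by move=> _ [M _ <-]; exact: cost_ge0.
have fin : (\int[coins]_w (F w)%:E)%E \is a fin_num.
  rewrite ge0_fin_numE; first by apply: le_lt_trans (key _ pD) _; rewrite ltry.
  by apply: integral_ge0 => w _; rewrite lee_fin.
apply: (@le_trans _ _ (C' * opt (revealed s i))%:E); last first.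
  rewrite lee_fin ler_wpM2r // /C'.
  have -> : 20000 * (ddim * (1 + ln (aspect_ratio (revealed s n)))) =
     (20000 * (1 + ln (aspect_ratio (revealed s n)))) * ddim by rewrite mulrCA mulrC.
  by rewrite ler_wpM2r //; lra.
rewrite -(fineK fin) lee_fin.
have key' M : perfect_matching M ->
    fine (\int[coins]_w (F w)%:E)%E <= C' * cost (revealed s i) M.
  by move=> pM; rewrite -lee_fin fineK // key.
(* The constant vanishes, for instance, when there are no levels; otherwise dividing by it turns the
   claim into a lower bound for the infimum. *)
have [C0|Cn0] := eqVneq C' 0.
  by have := key' _ pD; rewrite C0 !mul0r.
have Cp : 0 < C' by rewrite lt_neqAle eq_sym Cn0.
rewrite -ler_pdivrMl //; apply: lb_le_inf.
  by exists (cost (revealed s i) (matching_of i.*2 swap)); exists (matching_of i.*2 swap).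
by move=> _ [M pM <-]; rewrite ler_pdivrMl // key'.
Qed.

Lemma algorithm_recourse_aspect (X : metricType R) n (s : nat -> X) w :
  (recourse algorithm s n w)%:R <= 20000 * (1 + ln (aspect_ratio (revealed s n))).
Proof.
have [a [T [lo hi TP Phi0 ne]]] := level_range s n.
apply: (@le_trans _ _ (16 * T)%:R).
  rewrite ler_nat; apply/bigmax_leqP => i _.
  by apply: (deleted_le lo hi (ltn_ord i)) => p; exact: size_doubling_levels.
by rewrite natrM; lra.
Qed.

(** The number of doublings gives a bound linear in [ln n]; for [n >= 2], [ln n] is at least 1/2,
    hence at most four times its cube. *)
Lemma algorithm_recourse_log (X : metricType R) n (s : nat -> X) w :
  (recourse algorithm s n w)%:R <= 20000 * ln n%:R ^+ 3 :> R.
Proof.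
have [a [T [lo hi TP Phi0 ne]]] := level_range s n.
(* For [n <= 1] the right-hand side is 0, so no deletion at all may be allowed. *)
pose b := if (n <= 1)%N then 0%N else trunc_log 2 (4 * n).
apply: (@le_trans _ _ (16 * b)%:R).
  rewrite ler_nat; apply/bigmax_leqP => i _.
  apply: (deleted_le lo hi (ltn_ord i)) => p.
  have := exp_doubling_levels s a T w i p; have := ltn_ord i; rewrite /b.
  move: (size _) => z iN; case: ifP => n1 hz.
    have i0 : (i : nat) = 0%N by lia.
    by move: hz; rewrite i0; case: z => // z; rewrite expnS; have := expn_gt0 2 z; lia.
  apply: trunc_log_max => //; apply: leq_trans hz _; rewrite -muln2; lia.
rewrite /b; case: ifPn => n1.
  rewrite muln0; apply: mulr_ge0; first exact: ler0n.
  apply: exprn_ge0; case: n n1 {s w a T lo hi TP Phi0 ne b} => [|[|n]] // _.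
    by rewrite ln0.
  by rewrite ln1.
rewrite -ltnNge in n1.
set t := trunc_log _ _; have l2 := ln2_ge.
have n0 : 0 < n%:R :> R by rewrite ltr0n; lia.
have ln_n : ln 2 <= ln n%:R :> R by rewrite ler_ln ?posrE // ler_nat.
(* [2 ^ t] is at most [4 * n], and [ln 4] is at most [2 * ln n]. *)
have : t%:R * ln 2 <= 3 * ln n%:R :> R.
  rewrite mulr_natl -lnXn // -natrX.
  apply: (@le_trans _ _ (ln (4 * n)%:R)).
    rewrite ler_ln ?posrE ?ltr0n ?expn_gt0 //; last by lia.
    by rewrite ler_nat trunc_logP //; lia.
  rewrite natrM lnM ?posrE // -[4%N]/(2 ^ 2)%N natrX lnXn //.
  by rewrite mulr2n; lra.
rewrite natrM; move: (ln 2) l2 ln_n => l l2 ln_n tl.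
set L := ln _ in tl ln_n *.
have t6 : t%:R <= 6 * L by have := ler0n R t; nra.
have L0 : 0 <= L by lra.
have L2 : 1 / 4 <= L ^+ 2 by rewrite expr2; nra.
have : L * (1 / 4) <= L ^+ 3 by rewrite [leRHS]exprS ler_wpM2l.
lra.
Qed.
End Final.

Local Open Scope ring_scope.

Theorem theorem1p6 (R : realType) :
  exists2 C : R, 0 < C &
    (exists (d : measure_display) (Omega : measurableType d)
        (P : probability Omega R) (A : randomized_algorithm R Omega),
      forall (X : metricType R) (ddim : R) (n : nat) (s : nat -> X),
        has_doubling_dim X ddim ->
        let Phi := aspect_ratio (revealed s n) in
        expected_competitive P A s n (C * (ddim * (1 + ln Phi))) /\
        forall w : Omega, (recourse A s n w)%:R <= C * (1 + ln Phi))
    /\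
    (exists (d : measure_display) (Omega : measurableType d)
        (P : probability Omega R) (A : randomized_algorithm R Omega),
      forall (X : metricType R) (ddim : R) (n : nat) (s : nat -> X),
        has_doubling_dim X ddim ->
        let Phi := aspect_ratio (revealed s n) in
        expected_competitive P A s n (C * (ddim * (1 + ln Phi))) /\
        forall w : Omega, (recourse A s n w)%:R <= C * ln n%:R ^+ 3).
Proof.
exists 20000; first by rewrite ltr0n.
split; exists _, _, coins, algorithm => X ddim n s hX /=;
  (split; first exact: algorithm_competitive) => w.
- exact: algorithm_recourse_aspect.
- exact: algorithm_recourse_log.
Qed.
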